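(* Suppose Assumption 1 holds. Let $\hat\beta^{\mathrm{OLS}}=(X'X)^{-1}X'y$. Then $$r'\hat\beta^{\mathrm{OLS}}-r'\beta=\sigma^2\, r'\bar S^{-1}\alpha\sum_{t=2}^{T}\tilde M_{t,t-1}+o_p(1),$$ where $\bar S=\tilde X'\tilde X+\sigma^2(T-K)\,\alpha\alpha'$ and $\tilde M=I_T-\tilde X(\tilde X'\tilde X)^{-1}\tilde X'$ (with $\tilde M_{t,s}$ its $(t,s)$ entry).
   Context: Asymptotic framework: all objects may depend on the sample size $T$; limits, $O_p$ and $o_p$ are as $T\to\infty$; $c\in(0,1)$ and $C>0$ denote fixed constants not depending on $T$. Model: $y_t=x_t'\beta+\varepsilon_t$, $t=1,\dots,T$, with $x_t,\beta\in\mathbb R^K$; $y=(y_1,\dots,y_T)'$, $X=[x_1,\dots,x_T]'$ ($T\times K$), $\varepsilon=(\varepsilon_1,\dots,\varepsilon_T)'$. Assumption 1: (i) $x_t=\tilde x_t+\alpha\varepsilon_{t-1}$ for all $t$, where $\tilde X=[\tilde x_1,\dots,\tilde x_T]'$ is $T\times K$ of full column rank $K$; (ii) $\{\varepsilon_t\}_{t=0}^T$ are i.i.d. conditionally on $\tilde X$ with $E[\varepsilon_t\mid\tilde X]=0$, $c<\sigma^2:=E[\varepsilon_t^2\mid\tilde X]<C$ and $E[\varepsilon_t^4\mid\tilde X]<C$ almost surely; (iii) $\alpha,r\in\mathbb R^K$ are non-random with $\alpha'(\tfrac1T\tilde X'\tilde X)^{-1}\alpha=O_p(1)$ and $r'(\tfrac1T\tilde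 X'\tilde X)^{-1}r=O_p(1)$; (iv) $K$ may diverge with $T$ and $K/T<1-c$. *)

(* Defs.v *)
From HB Require Import structures.
From mathcomp Require Import all_boot all_order all_algebra.
From mathcomp Require Import all_classical all_reals all_analysis.
Set Implicit Arguments. Unset Strict Implicit. Unset Printing Implicit Defensive.
Import Order.TTheory GRing.Theory Num.Theory.
Local Open Scope classical_set_scope.
Local Open Scope ring_scope.

Section Defs.
Context {R : realType} {d : measure_display} {Omega : measurableType d}.

(* "outer probability of S is < eta": S is covered by a measurable set of
   probability < eta (for measurable S this is just P S < eta). *)
Definition outer_lt (P : probability Omega R) (S : set Omega) (eta : R) : Prop :=
  exists A, measurable A /\ S `<=` A /\ (P A < eta%:E)%E.

Definition bigOp1 (P : probability Omega R) (Z : nat -> Omega -> R) : Prop :=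
  forall eta : R, 0 < eta -> exists M : R, exists N : nat, forall T : nat,
    (N <= T)%N -> outer_lt P [set w | M < `|Z T w|] eta.

Definition littleop1 (P : probability Omega R) (Z : nat -> Omega -> R) : Prop :=
  forall delta eta : R, 0 < delta -> 0 < eta -> exists N : nat, forall T : nat,
    (N <= T)%N -> outer_lt P [set w | delta < `|Z T w|] eta.

Definition sigmaX m n (Xt : Omega -> 'M[R]_(m, n)) : set (set Omega) :=
  <<s [set A | exists i j (B : set R), measurable B /\
                 A = (fun w => Xt w i j) @^-1` B] >>.

(* conditional i.i.d.-ness of eps_0..eps_T given sigma(Xt), with regular
   conditional law q w of each eps_j *)
Definition cond_iid m n T (P : probability Omega R) (Xt : Omega -> 'M[R]_(m, n))
    (eps : 'I_T.+1 -> Omega -> R) (q : Omega -> probability R R) : Prop :=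
  (forall B : set R, measurable B -> forall Y : set R, measurable Y ->
      sigmaX Xt ((fun w => fine (q w B)) @^-1` Y)) /\
  (forall A, sigmaX Xt A -> forall B : 'I_T.+1 -> set R,
      (forall j, measurable (B j)) ->
      P (A `&` \big[setI/setT]_(j < T.+1) (eps j @^-1` B j)) =
      (\int[P]_(w in A) \big[*%E/1%E]_(j < T.+1) q w (B j))%E).

Definition sigma2 (q : Omega -> probability R R) (w : Omega) : R :=
  fine (\int[q w]_x ((x ^+ 2)%:E))%E.

(* regressors: row t (0-based i) is xt_t' + eps_{t-1} alpha' *)
Definition lagvec T (eps : 'I_T.+1 -> Omega -> R) (w : Omega) : 'cV[R]_T :=
  \col_(i < T) eps (widen_ord (leqnSn T) i) w.
Definition errvec T (eps : 'I_T.+1 -> Omega -> R) (w : Omega) : 'cV[R]_T :=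
  \col_(i < T) eps (lift ord0 i) w.
Definition Xmat T K (Xt : 'M[R]_(T, K)) (alpha : 'cV[R]_K) (e : 'cV[R]_T)
  : 'M[R]_(T, K) := Xt + e *m alpha^T.
Definition yvec T K (X : 'M[R]_(T, K)) (beta : 'cV[R]_K) (u : 'cV[R]_T) : 'cV[R]_T :=
  X *m beta + u.
Definition ols T K (X : 'M[R]_(T, K)) (y : 'cV[R]_T) : 'cV[R]_K :=
  invmx (X^T *m X) *m X^T *m y.
Definition annih T K (Xt : 'M[R]_(T, K)) : 'M[R]_T :=
  1%:M - Xt *m invmx (Xt^T *m Xt) *m Xt^T.
Definition subdiag_sum T (M : 'M[R]_T) : R :=
  \sum_(i < T) \sum_(j < T | val i == (val j).+1) M i j.
Definition Sbar T K (Xt : 'M[R]_(T, K)) (s2 : R) (alpha : 'cV[R]_K) : 'M[R]_K :=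
  Xt^T *m Xt + (s2 * (T%:R - K%:R)) *: (alpha *m alpha^T).

End Defs.

(* Main.v *)
(** With e the lagged and u the current errors, M = annih X~ and k = 1 + alpha' G^-1 X~' e
(G = X~' X~), one has X = X~ N + M e alpha' for N = I + G^-1 X~' e alpha', and M X~ = 0. Hence
X'X = N' (G + (m / k^2) alpha alpha') N with m = e' M e, and two applications of the
Sherman-Morrison formula express the OLS error through finitely many scalars: linear forms in e
and u with weights X~ G^-1 r and X~ G^-1 alpha, the quadratic forms e' M u and e' M e, and
quantities depending on X~ only. The linear forms are O_p(T^-1/2), and the quadratic forms deviate
by O_p(T^1/2) from sigma^2 sum_t M_(t,t-1) and sigma^2 (T - K). Both rates come from conditional
second-moment bounds for martingale sums along the filtration sigma(X~, eps_0, ..., eps_(k-1)).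
Expanding, T^1/2 times the difference in the theorem is a polynomial in O_p(1) terms. *)

Require Import Defs.
From HB Require Import structures.
From mathcomp Require Import all_boot all_order all_algebra.
From mathcomp Require Import ring lra.
From mathcomp Require Import all_classical all_reals all_analysis.
From mathcomp Require Import measurable_realfun.
Import Order.TTheory GRing.Theory Num.Theory.
Local Open Scope classical_set_scope.
Local Open Scope ring_scope.
Set Implicit Arguments. Unset Strict Implicit. Unset Printing Implicit Defensive.

(** The vectors [e] and [u] share all but one entry each, so neither can be frozen while the other
    is averaged. Both are read off the single vector [eps 0, ..., eps T] with weights padded by
    zeros; the diagonal of the padded form [e' M u] is then the subdiagonal of [M], which is the
    source of the leading term. Assumption (iii) bounds the weights of the linear forms only in
    probability, so these weights may have no moments: their second moments are taken on an event of
    sigma(X~), which keeps the weights predictable. No conditional expectation is formed; the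
    regular law [q] turns conditioning into iterated integrals of nonnegative functions. The OLS
    error is kept as an exact rational function of the scalars. Its denominator k^2 + m alpha' G^-1
    alpha is at least k^2, because m and alpha' G^-1 alpha are nonnegative, so it suffices to keep
    [k] away from 0, and [k] tends to 1 in probability. *)

Lemma mulmx_scal11 (F : comNzRingType) m n p (A : 'M[F]_(m, 1)) (u : 'rV[F]_n) (v : 'cV[F]_n)
    (B : 'M[F]_(1, p)) :
  A *m u *m (v *m B) = (u *m v) 0 0 *: (A *m B).
Proof.
rewrite -mulmxA (mulmxA u) {1}[u *m v]mx11_scalar mul_scalar_mx.
by rewrite -scalemxAr.
Qed.

(** * The OLS error as a function of scalars *)

(** A right inverse of a square matrix is two-sided, so one product is checked. Invertibility is
    part of the conclusion because [invmx] returns its argument on a singular matrix. *)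
Lemma sherman_morrison (F : fieldType) n (A : 'M[F]_n) (u v : 'cV[F]_n) :
  A \in unitmx -> 1 + (v^T *m invmx A *m u) 0 0 != 0 ->
  A + u *m v^T \in unitmx /\
  invmx (A + u *m v^T) =
    invmx A - (1 + (v^T *m invmx A *m u) 0 0)^-1 *: (invmx A *m u *m (v^T *m invmx A)).
Proof.
move=> uA; set s := (_ *m u) 0 0 => s0; set B := invmx A - _.
have E : (A + u *m v^T) *m B = 1%:M.
  rewrite /B mulmxBr !mulmxDl mulmxV // -!scalemxAr !mulmxA mulmxV // mul1mx.
  have -> : u *m v^T *m invmx A *m u *m v^T *m invmx A = s *: (u *m v^T *m invmx A).
    by rewrite -(mulmxA u v^T) /s -mulmx_scal11 !mulmxA.
  set W := u *m v^T *m _; rewrite -scalerDr -[X in _ *: (X + _)]scale1r -scalerDl.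
  by rewrite scalerA mulVf // scale1r addrK.
have [uAu _] := mulmx1_unit E; split => //.
by rewrite -[LHS]mulmx1 -E mulmxA mulVmx // mul1mx.
Qed.

Section ols_error.
Variables (F : fieldType) (T K : nat) (Y : 'M[F]_(T, K)) (a r : 'cV[F]_K) (e u : 'cV[F]_T).
Let G := Y^T *m Y.
Let M : 'M[F]_T := 1%:M - Y *m invmx G *m Y^T.
Let aGa := (a^T *m invmx G *m a) 0 0.
Let rGa := (r^T *m invmx G *m a) 0 0.
Let ha := Y *m invmx G *m a.
Let hr := Y *m invmx G *m r.
Let A1 := (hr^T *m u) 0 0.
Let p := (hr^T *m e) 0 0.
Let b := (ha^T *m u) 0 0.
Let k := 1 + (ha^T *m e) 0 0.
Let m := (e^T *m M *m e) 0 0.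
Let s := (e^T *m M *m u) 0 0.
Let D := k ^+ 2 + m * aGa.
Hypothesis uG : G \in unitmx.

Let trG : G^T = G. Proof. by rewrite /G trmx_mul trmxK. Qed.
Let trV : (invmx G)^T = invmx G. Proof. by rewrite trmx_inv trG. Qed.

Lemma annih_mulmx : M *m Y = 0.
Proof. by rewrite /M mulmxBl mul1mx -!mulmxA mulVmx // mulmx1 subrr. Qed.

Lemma annih_sym : M^T = M.
Proof. by rewrite /M linearB /= trmx1 !trmx_mul trmxK trV mulmxA. Qed.

Lemma annih_idem : M *m M = M.
Proof. by rewrite {2}/M mulmxBr mulmx1 !mulmxA annih_mulmx !mul0mx subr0. Qed.

Lemma ols_error_formula : k != 0 -> D != 0 ->
  let X := Y + e *m a^T in
  X^T *m X \in unitmx /\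
  (r^T *m (invmx (X^T *m X) *m X^T *m u)) 0 0 =
    A1 - p * b / k + (rGa - p * aGa / k) * (k * s - m * b) / D.
Proof.
move=> k0 D0 X.
pose g := invmx G *m Y^T *m e.
pose N : 'M[F]_K := 1%:M + g *m a^T.
have ag : (a^T *m g) 0 0 = k - 1.
  by rewrite /k addrC addKr /ha !trmx_mul trV /g !mulmxA.
have EX : X = Y *m N + M *m e *m a^T.
  rewrite /N mulmxDr mulmx1 /M mulmxBl mulmxBl mul1mx /g !mulmxA.
  by rewrite -addrA [X in _ + X]addrC subrK.
have [uN VN] : N \in unitmx /\ invmx N = 1%:M - k^-1 *: (g *m a^T).
  have := @sherman_morrison F K 1%:M g a; rewrite unitmx1 invmx1 mulmx1 mul1mx ag.
  by rewrite [1 + _]addrC subrK => /(_ isT k0).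
(* Since [N^T *m a = k *: a], factoring [N] out on both sides divides the rank-one term by k^2. The
   Sherman-Morrison pivot of the middle factor is then [D / k ^+ 2]. *)
pose l := m / k ^+ 2.
have l0 : 1 + (( l *: a)^T *m invmx G *m a) 0 0 != 0.
  rewrite linearZ /= -!scalemxAl mxE -/aGa.
  rewrite (_ : 1 + _ = D / k ^+ 2); last by rewrite /D /l; field.
  by rewrite mulf_neq0 // invr_eq0 expf_neq0.
have [uS _] := sherman_morrison uG l0.
have Na : N^T *m a = k *: a.
  rewrite /N linearD /= trmx1 mulmxDl mul1mx trmx_mul trmxK -mulmxA.
  have -> : g^T *m a = (k - 1)%:M.
    by rewrite -ag [LHS]mx11_scalar -[in LHS](trmxK a) -trmx_mul [X in X%:M]mxE.
  by rewrite mul_mx_scalar scalerBl scale1r addrCA subrr addr0.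
have aN : a^T *m N = k *: a^T by rewrite -[LHS]trmxK trmx_mul trmxK Na linearZ.
have MYe : Y^T *m (M *m e) = 0.
  by rewrite mulmxA -[Y^T *m M]trmxK trmx_mul annih_sym trmxK annih_mulmx trmx0 mul0mx.
have eMY : (M *m e)^T *m Y = 0.
  by rewrite trmx_mul annih_sym -mulmxA annih_mulmx mulmx0.
have eMMe : (M *m e)^T *m (M *m e) = m%:M.
  by rewrite trmx_mul annih_sym mulmxA -(mulmxA _ M M) annih_idem -mx11_scalar.
have XT : X^T = N^T *m Y^T + a *m (M *m e)^T.
  by rewrite EX linearD /= (trmx_mul Y N) (trmx_mul (M *m e)) trmxK.
clearbody X N.
have EXX : X^T *m X = N^T *m (G + a *m (l *: a)^T) *m N.
  transitivity (N^T *m G *m N + m *: (a *m a^T)).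
    rewrite XT EX; move: (M *m e) MYe eMY eMMe => w Yw wY ww.
    rewrite mulmxDl !mulmxDr -!(mulmxA N^T) !(mulmxA Y^T) Yw mul0mx mulmx0 addr0.
    by rewrite -!(mulmxA a) !(mulmxA w^T) wY ww mul0mx mulmx0 add0r mul_scalar_mx -scalemxAr.
  rewrite mulmxDr (mulmxDl _ _ N) (mulmxA N^T a) Na linearZ /= -scalemxAr.
  rewrite -!scalemxAl -(mulmxA a) aN -scalemxAr !scalerA; congr (_ + _ *: _).
  by rewrite /l; field.
have uX : X^T *m X \in unitmx by rewrite EXX !unitmx_mul unitmx_tr uN uS.
split => //.
(* The normal equations are solved by an ansatz instead of inverting the middle factor: X'u = N'
   (Y'u + (s / k) a), so the coefficient of [a] must satisfy rho + (m / k^2) (b + rho aGa) = s / k,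
   whose solution is [rho]. *)
pose rho := (k * s - m * b) / D.
pose v := invmx N *m (invmx G *m Y^T *m u + rho *: (invmx G *m a)).
have ahu : a^T *m (invmx G *m Y^T *m u) = b%:M.
  by rewrite [LHS]mx11_scalar /b /ha !trmx_mul trV !mulmxA.
have aGaE : a^T *m (invmx G *m a) = aGa%:M.
  by rewrite [LHS]mx11_scalar /aGa !mulmxA.
have Gh1 : G *m (invmx G *m Y^T *m u) = Y^T *m u by rewrite !mulmxA mulmxV // mul1mx.
have Gh2 : G *m (invmx G *m a) = a by rewrite mulmxA mulmxV // mul1mx.
have Ev : X^T *m X *m v = X^T *m u.
  rewrite EXX /v; move: (invmx G *m Y^T *m u) (invmx G *m a) ahu aGaE Gh1 Gh2 => h1 h2.
  move=> ah1 ah2 Gh1 Gh2; rewrite mulmxA mulmxK // -mulmxA mulmxDl !mulmxDr -!scalemxAr.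
  rewrite Gh1 Gh2 -!(mulmxA a) linearZ /= -!scalemxAl ah1 ah2 -!scalemxAr !mul_mx_scalar.
  rewrite -!scalemxAr Na XT mulmxDl -!mulmxA trmx_mul annih_sym.
  rewrite [e^T *m M *m u]mx11_scalar -/s mul_mx_scalar.
  rewrite -addrA; congr (_ + _); rewrite !scalerA -!scalerDl; congr (_ *: _).
  by rewrite /rho /l /D; field; rewrite k0.
have -> : invmx (X^T *m X) *m X^T *m u = v by rewrite -mulmxA -Ev mulKmx.
have rh1 : r^T *m (invmx G *m Y^T *m u) = A1%:M.
  by rewrite [LHS]mx11_scalar /A1 /hr !trmx_mul trV !mulmxA.
have rh2 : r^T *m (invmx G *m a) = rGa%:M by rewrite [LHS]mx11_scalar /rGa !mulmxA.
have rg : r^T *m g = p%:M by rewrite [LHS]mx11_scalar /p /hr !trmx_mul trV /g !mulmxA.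
rewrite /v VN; move: (invmx G *m Y^T *m u) (invmx G *m a) ahu aGaE rh1 rh2 => h1 h2.
move=> ah1 ah2 rh1 rh2; clearbody g.
rewrite mulmxBl mul1mx -scalemxAl -mulmxA !mulmxDr -!scalemxAr ah1 ah2.
rewrite !(mulmxN, mulmxDr) -!scalemxAr !mulmxDr -!scalemxAr !mul_mx_scalar -!scalemxAr rh1 rh2 rg.
rewrite !mxE /= !mulr1n /rho; move: (D) D0 => D1 D10; by field; rewrite k0 D10.
Qed.
End ols_error.

(* In the application [t = sqrt T], [x1 .. x4] are [t] times the linear forms (so [k = 1 + x4 / t]),
   [x5] and [x6] are the centred quadratic forms [e' M u] and [e' M e] over [t], [x7] and [x8] are
   [T alpha' G^-1 alpha] and [T r' G^-1 alpha]. *)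
Lemma scaled_error_expansion (F : fieldType) (t x1 x2 x3 x4 x5 x6 x7 x8 y z : F) :
  let k := 1 + x4 / t in
  let D := k ^+ 2 + (z + x6 / t) * x7 in
  let E := 1 + z * x7 in
  t != 0 -> k != 0 -> D != 0 -> E != 0 ->
  t * (x1 / t - x2 / t * (x3 / t) / k
       + (x8 / t ^+ 2 - x2 / t * (x7 / t ^+ 2) / k)
         * (k * (t * x5 + t ^+ 2 * y) - (t ^+ 2 * z + t * x6) * (x3 / t)) / D
       - x8 * y / E)
  = x1 - x2 * x3 * k^-1 * t^-1
    - x2 * x7 * k^-1 * D^-1 * (k * (y + x5 * t^-1) - (z + x6 * t^-1) * x3 * t^-1)
    - x8 * (z + x6 * t^-1) * x3 * D^-1 + x8 * k * x5 * D^-1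
    + x8 * y * (x4 * z * x7 - k * x4 - x6 * x7) * D^-1 * E^-1.
Proof.
move=> k D E t0 k0 D0 E0.
(* The only terms with a surplus factor [t] combine into [x8 * y * t * (k / D - 1 / E)]. The
   difference [k * E - D] is of order [1 / t], and this identity is the cancellation that absorbs
   the factor. *)
have <- : t * (k * E - D) = x4 * z * x7 - k * x4 - x6 * x7 by rewrite /E /D /k; field.
by move: (k) (D) (E) k0 D0 E0 => k1 D1 E1 k0 D0 E0; field; rewrite t0 k0 D0 E0.
Qed.

(** * Gram matrices and annihilators over a real field *)

Section real_annih.
Variables (F : realFieldType) (T K : nat) (Y : 'M[F]_(T, K)).
Let G := Y^T *m Y.
Let M : 'M[F]_T := 1%:M - Y *m invmx G *m Y^T.

Lemma dotmx_ge0 n (v : 'cV[F]_n) : 0 <= (v^T *m v) 0 0.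
Proof. by rewrite mxE sumr_ge0 // => i _; rewrite mxE -expr2 sqr_ge0. Qed.

Lemma dotmx_sum n (v : 'cV[F]_n) : (v^T *m v) 0 0 = \sum_i v i 0 ^+ 2.
Proof. by rewrite mxE; apply: eq_bigr => i _; rewrite mxE -expr2. Qed.

Lemma gram_unitmx : \rank Y = K -> G \in unitmx.
Proof.
move=> rY; rewrite -row_free_unit -kermx_eq0; apply/eqP/row_matrixP => i; rewrite row0.
set v := row i _.
have vG : v *m G = 0 by rewrite /v -row_mul mulmx_ker row0.
have : ((Y *m v^T)^T *m (Y *m v^T)) 0 0 = 0.
  by rewrite trmx_mul trmxK -mulmxA (mulmxA Y^T) mulmxA vG mul0mx mxE.
rewrite dotmx_sum => /eqP; rewrite psumr_eq0; last by move=> j _; rewrite sqr_ge0.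
move/allP => h.
have Yv : v *m Y^T = 0.
  apply/rowP => j; rewrite [RHS]mxE.
  have := h j; rewrite mem_index_enum => /(_ isT); rewrite sqrf_eq0 => /eqP.
  by rewrite -[Y *m _]trmxK trmx_mul !trmxK mxE.
have fY : row_free Y^T by rewrite /row_free mxrank_tr rY.
by apply: (row_free_inj fY); rewrite mul0mx.
Qed.

Hypothesis uG : G \in unitmx.

(** G^-1 = (Y G^-1)' (Y G^-1). This turns the quantities of Assumption (iii) into squared norms of
    the weight vectors of the linear forms. *)
Lemma gram_form (a r : 'cV[F]_K) :
  (r^T *m invmx G *m a) 0 0 = ((Y *m invmx G *m r)^T *m (Y *m invmx G *m a)) 0 0.
Proof.
rewrite !trmx_mul trmx_inv /G trmx_mul trmxK -/G !mulmxA -(mulmxA _ Y^T Y) -/G.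
by rewrite -(mulmxA r^T _ G) mulVmx // mulmx1.
Qed.

Lemma gram_form_ge0 (a : 'cV[F]_K) : 0 <= (a^T *m invmx G *m a) 0 0.
Proof. by rewrite gram_form dotmx_ge0. Qed.

(** A crude substitute for Cauchy-Schwarz, sufficient to bound the mixed term r' G^-1 alpha by the
    two pure ones. *)
Lemma dotmx_le n (u v : 'cV[F]_n) :
  `|(u^T *m v) 0 0| <= (u^T *m u) 0 0 + (v^T *m v) 0 0.
Proof.
rewrite !dotmx_sum mxE -big_split /=; apply: (le_trans (ler_norm_sum _ _ _)).
apply: ler_sum => i _; rewrite mxE normrM -(real_normK (num_real (u i 0))).
rewrite -(real_normK (num_real (v i 0))).
by move: `|u i 0| `|v i 0| (normr_ge0 (u i 0)) (normr_ge0 (v i 0)) => x y; nra.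
Qed.

Lemma annih_form_ge0 (e : 'cV[F]_T) : 0 <= (e^T *m M *m e) 0 0.
Proof.
suff -> : e^T *m M *m e = (M *m e)^T *m (M *m e) by exact: dotmx_ge0.
by rewrite trmx_mul (annih_sym Y) mulmxA -(mulmxA _ _ M) [M *m M](annih_idem uG).
Qed.

Lemma annih_trace : \tr M = T%:R - K%:R.
Proof.
rewrite /M linearB /= mxtrace1 mxtrace_mulC mulmxA mxtrace_mulC mulmxA.
by rewrite -(mulmxA (invmx G)) ?mulVmx // mxtrace1.
Qed.

(** For a symmetric idempotent the squared Frobenius norm equals the trace. Being at most [T], it
    yields the T^1/2 deviation of the quadratic forms. *)
Lemma annih_sum_sq : \sum_i \sum_j M i j ^+ 2 = T%:R - K%:R.
Proof.
transitivity (\tr (M *m M)); last by rewrite [_ *m _](annih_idem uG) annih_trace.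
rewrite /mxtrace; apply: eq_bigr => i _.
rewrite mxE; apply: eq_bigr => j _; rewrite expr2; congr (_ * _).
by have /matrixP/(_ i j) := annih_sym Y; rewrite [LHS]mxE => <-.
Qed.

End real_annih.

(** Sherman-Morrison for the rank-one update in [Sbar]: [a] stays on the line of G^-1 a, so only a
    scalar denominator appears. It is at least 1 because [s2] and [T - K] are nonnegative. *)
Lemma Sbar_form (R : realType) T K (Y : 'M[R]_(T, K)) (a r : 'cV[R]_K) (s2 : R) :
  Y^T *m Y \in unitmx -> 0 <= s2 -> (K <= T)%N ->
  (r^T *m invmx (Sbar Y s2 a) *m a) 0 0 =
  (r^T *m invmx (Y^T *m Y) *m a) 0 0 /
    (1 + s2 * (T%:R - K%:R) * (a^T *m invmx (Y^T *m Y) *m a) 0 0).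
Proof.
move=> uG s0 KT; set G := Y^T *m Y; set l := s2 * _.
have l0 : 0 <= l by rewrite mulr_ge0 // subr_ge0 ler_nat.
have g0 := gram_form_ge0 uG a; rewrite -/G in g0.
have E : (a^T *m invmx G *m (l *: a)) 0 0 = l * (a^T *m invmx G *m a) 0 0.
  by rewrite -scalemxAr mxE.
set g := (a^T *m invmx G *m a) 0 0 in g0 E *.
have d0 : 1 + l * g != 0 by rewrite gt_eqF // ltr_pwDl ?ltr01 // mulr_ge0.
have := @sherman_morrison _ _ G (l *: a) a uG; rewrite E => /(_ d0) [_ H].
rewrite /Sbar -/G -/l scalemxAl H mulmxBr mulmxBl -scalemxAr -scalemxAl.
have -> : r^T *m (invmx G *m (l *: a) *m (a^T *m invmx G)) *m a
    = (l * g) *: (r^T *m invmx G *m a).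
  rewrite -scalemxAr -scalemxAl -scalemxAr -scalemxAl -scalerA; congr (_ *: _).
  rewrite !mulmxA -2!(mulmxA (r^T *m invmx G *m a)).
  by rewrite [a^T *m _ *m a]mx11_scalar -/g mul_mx_scalar.
rewrite !mxE; move: (\sum_j _) (1 + l * g) d0 (addKr 1 (l * g)) => x D D0 DE.
by rewrite -DE; field; exact: D0.
Qed.

(** * Stochastic orders *)

Section op_calculus.
Context {R : realType} {d : measure_display} {Omega : measurableType d}.
Variable P : probability Omega R.
Implicit Types (S : set Omega) (Z W V : nat -> Omega -> R) (G : nat -> set Omega).

(** Formulated with the outer probability of the complement, so that [G T] need not be measurable.
    It also absorbs facts that hold only for large [T]. *)
Definition whp G := forall eta : R, 0 < eta -> exists N : nat, forall T : nat,
  (N <= T)%N -> outer_lt P (~` G T) eta.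

Lemma outer_ltS S S' (a : R) : S `<=` S' -> outer_lt P S' a -> outer_lt P S a.
Proof. by move=> SS' [A [mA [SA PA]]]; exists A; split=> //; split=> //; apply: subset_trans SA. Qed.

Lemma outer_ltU S S' (a b : R) :
  outer_lt P S a -> outer_lt P S' b -> outer_lt P (S `|` S') (a + b).
Proof.
move=> [A [mA [SA PA]]] [B [mB [SB PB]]]; exists (A `|` B); split; first exact: measurableU.
split; first exact: setUSS.
by rewrite EFinD; apply: le_lt_trans (lteD PA PB); apply: measureU2.
Qed.

Lemma whpI G G' : whp G -> whp G' -> whp (fun T => G T `&` G' T).
Proof.
move=> h h' eta eta0; have e2 : 0 < eta / 2 by rewrite divr_gt0.
have [N HN] := h _ e2; have [N' HN'] := h' _ e2; exists (maxn N N') => T.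
rewrite geq_max => /andP[NT NT']; rewrite setCI (splitr eta).
by apply: outer_ltU; [exact: HN|exact: HN'].
Qed.

Lemma whp_ae (G : nat -> Omega -> Prop) : (forall T, {ae P, forall w, G T w}) -> whp G.
Proof.
move=> h eta eta0; exists 0%N => T _; have [A [mA A0 GA]] := h T.
by exists A; split=> //; split=> //; rewrite A0 lte_fin.
Qed.

Lemma whp_event (n : nat) G : (forall T, (n <= T)%N -> G T = setT) -> whp G.
Proof.
move=> h eta eta0; exists n => T nT; rewrite h // setCT; exists set0; split=> //; split=> //.
by rewrite measure0 lte_fin.
Qed.

(** Domination is required on a likely event only. This is how bounds that fail when a denominator
    is small enter the calculus. *)
Lemma bigOp1_whp G Z W : whp G -> bigOp1 P W ->
  (forall T w, G T w -> `|Z T w| <= `|W T w|) -> bigOp1 P Z.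
Proof.
move=> hG hW ZW eta eta0; have e2 : 0 < eta / 2 by rewrite divr_gt0.
have [N HN] := hG _ e2; have [M [N' HN']] := hW _ e2; exists M, (maxn N N') => T.
rewrite geq_max => /andP[/HN o1 /HN' o2]; rewrite (splitr eta).
apply: outer_ltS (outer_ltU o1 o2) => w /= MZ.
have [Gw|?] := pselect (G T w); [right|by left].
exact: lt_le_trans MZ (ZW _ _ Gw).
Qed.

Lemma bigOp1_bounded G Z (B : R) : whp G ->
  (forall T w, G T w -> `|Z T w| <= B) -> bigOp1 P Z.
Proof.
move=> hG ZB; apply: (@bigOp1_whp G Z (fun _ _ => B)) => //.
  move=> eta eta0; exists `|B|, 0%N => T _; exists set0; split=> //; split.
    by move=> w /=; rewrite ltxx.
  by rewrite measure0 lte_fin.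
by move=> T w /ZB /le_trans; apply; exact: ler_norm.
Qed.

Lemma bigOp1_cst (B : R) : bigOp1 P (fun _ _ => B).
Proof. by apply: (@bigOp1_bounded (fun _ => setT) _ `|B|) => //; apply: (@whp_event 0). Qed.

Lemma bigOp1D Z W : bigOp1 P Z -> bigOp1 P W -> bigOp1 P (fun T w => Z T w + W T w).
Proof.
move=> hZ hW eta eta0; have e2 : 0 < eta / 2 by rewrite divr_gt0.
have [M [N HN]] := hZ _ e2; have [M' [N' HN']] := hW _ e2; exists (M + M'), (maxn N N') => T.
rewrite geq_max => /andP[/HN o1 /HN' o2]; rewrite (splitr eta).
apply: outer_ltS (outer_ltU o1 o2) => w /= H.
have [ZM|MZ] := leP `|Z T w| M; last by left.
right => /=; rewrite ltNge; apply/negP => WM.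
by move: H; rewrite ltNge (le_trans (ler_normD _ _)) // lerD.
Qed.

Lemma bigOp1M Z W : bigOp1 P Z -> bigOp1 P W -> bigOp1 P (fun T w => Z T w * W T w).
Proof.
move=> hZ hW eta eta0; have e2 : 0 < eta / 2 by rewrite divr_gt0.
have [M [N HN]] := hZ _ e2; have [M' [N' HN']] := hW _ e2; exists (`|M| * `|M'|), (maxn N N') => T.
rewrite geq_max => /andP[/HN o1 /HN' o2]; rewrite (splitr eta).
apply: outer_ltS (outer_ltU o1 o2) => w /= H.
have [ZM|MZ] := leP `|Z T w| M; last by left.
right => /=; rewrite ltNge; apply/negP => WM.
move: H; rewrite ltNge normrM ler_pM //.
  exact: le_trans ZM (ler_norm _).
exact: le_trans WM (ler_norm _).
Qed.

Lemma bigOp1N Z : bigOp1 P Z -> bigOp1 P (fun T w => - Z T w).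
Proof.
by move=> h eta /h [M [N HN]]; exists M, N => T /HN; under eq_set do rewrite -normrN.
Qed.

Lemma bigOp1_whp_small Z (delta : R) : 0 < delta ->
  bigOp1 P (fun T w => Num.sqrt T%:R * Z T w) -> whp (fun T => [set w | `|Z T w| <= delta]).
Proof.
move=> d0 h eta /h [M [N HN]].
(* Chosen so that [T > n] gives sqrt T >= M / delta; then [delta < |Z|] forces sqrt T |Z| > M. *)
pose n := Num.truncn ((M / delta) ^+ 2).
exists (maxn N n.+1) => T; rewrite geq_max => /andP[/HN o nT].
apply: outer_ltS o => w /= /negP; rewrite -ltNge => dZ.
have T0 : 0 < Num.sqrt T%:R :> R by rewrite sqrtr_gt0 ltr0n (leq_trans _ nT).
rewrite normrM (gtr0_norm T0).
apply: le_lt_trans (_ : Num.sqrt T%:R * delta < _); last by rewrite ltr_pM2l.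
rewrite -ler_pdivrMr //; apply: le_trans (ler_norm _) _.
rewrite -sqrtr_sqr ler_sqrt //.
apply: ltW; apply: lt_le_trans (_ : n.+1%:R <= _); last by rewrite ler_nat.
by rewrite /n truncnS_gt.
Qed.

Lemma bigOp1_littleop1 Z :
  bigOp1 P (fun T w => Num.sqrt T%:R * Z T w) -> littleop1 P Z.
Proof.
move=> h delta eta d0 /(bigOp1_whp_small d0 h) [N HN]; exists N => T /HN.
by apply: outer_ltS => w /= /lt_geF ->.
Qed.

(** Chebyshev's inequality after truncation: [V] controls the conditional second moment of [Z] but
    may itself have no moment, so the bound [B] is allowed to depend on the truncation level [M]. *)
Lemma bigOp1_second_moment Z V :
  bigOp1 P V ->
  (forall M : R, exists B : R, exists N, forall T, (N <= T)%N ->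
     measurable_fun setT (Z T) /\ measurable [set w | `|V T w| <= M] /\
     (\int[P]_(w in [set w | (`|V T w| <= M)%R]) ((Z T w) ^+ 2)%:E <= B%:E)%E) ->
  bigOp1 P Z.
Proof.
move=> hV h eta eta0; have e2 : 0 < eta / 2 by rewrite divr_gt0.
have [M [N1 H1]] := hV _ e2; have [B [N2 H2]] := h M.
(* This gives a^2 > 4 |B| / eta, so Chebyshev bounds the truncated part strictly below eta / 2. The
   summand 1 keeps [a] positive and the inequality strict when [B] is 0. *)
pose a := Num.sqrt (`|B| / (eta / 4)) + 1.
have a0 : 0 < a by rewrite ltr_wpDl // sqrtr_ge0.
exists a, (maxn N1 N2) => T; rewrite geq_max => /andP[/H1 o1 /H2 [mZ [mE HB]]].
rewrite (splitr eta); pose E := [set w | `|V T w| <= M].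
pose A := E `&` [set w | a <= `|Z T w|].
apply: (@outer_ltS _ ([set w | M < `|V T w|] `|` A)) => [w /= aZ|].
  by have [?|?] := leP `|V T w| M; [right; split=> //; apply: ltW|left].
have mA : measurable A.
  apply: measurableI => //; rewrite -[X in measurable X]setTI.
  by apply: measurable_fun_le => //; apply: measurableT_comp.
apply: outer_ltU => //; exists A; split => //; split => //.
have : ((a ^+ 2)%:E * P A <= B%:E)%E.
  apply: le_trans HB.
  rewrite -integral_cst //; apply: (@le_trans _ _ (\int[P]_(w in A) (Z T w ^+ 2)%:E)%E).
    apply: ge0_le_integral => //.
    - by move=> w _; rewrite lee_fin sqr_ge0.
    - apply/measurable_EFinP; apply: measurable_funX; exact: measurable_funTS.
    - by move=> w [_ /= aZ]; rewrite lee_fin -(real_normK (num_real (Z T w))) ler_sqr ?nnegrE // (ltW a0).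
  apply: ge0_subset_integral => //.
  - apply/measurable_EFinP; apply: measurable_funX; exact: measurable_funTS.
  - by move=> w _; rewrite lee_fin sqr_ge0.
  - by move=> w [].
have fA : P A \is a fin_num by apply: fin_num_measure.
rewrite -(fineK fA) -EFinM !(lee_fin, lte_fin); set p := fine _ => h2.
have p0 : 0 <= p by apply: fine_ge0.
have h3 : `|B| / (eta / 4) < a ^+ 2.
  rewrite -[X in X < _]sqr_sqrtr ?ltr_sqr ?nnegrE ?sqrtr_ge0 ?(ltW a0) ?ltrDl //.
  by rewrite divr_ge0 // ltW // divr_gt0.
rewrite ltNge; apply/negP => h4.
have e4 : 0 < eta / 4 by rewrite divr_gt0.
have := ler_norm B; move: h3; rewrite ltr_pdivrMr // => h3 h5.
nra.
Qed.

End op_calculus.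

Import HBNNSimple.

(** * Uniqueness of integral-like functionals *)

Section integral_like.
Context {d : measure_display} {X : measurableType d} {R : realType}.
Local Open Scope ereal_scope.
Implicit Types (f g : X -> \bar R) (J : (X -> \bar R) -> \bar R).

Definition nnmeas f := (forall x, 0 <= f x) /\ measurable_fun setT f.

(** The properties shared by f -> E[f(phi) H] and by iterated integrals against a kernel. Comparing
    such functionals directly avoids constructing the measures they represent. *)
Record integral_like J : Prop := IntegralLike {
  integral_like_ge0 : forall f, nnmeas f -> 0 <= J f;
  integral_likeZ : forall (c : R) f, (0 <= c)%R -> nnmeas f ->
    J (fun x => c%:E * f x) = c%:E * J f;
  integral_likeD : forall f g, nnmeas f -> nnmeas g ->
    J (fun x => f x + g x) = J f + J g;
  integral_like_lim : forall f_ : nat -> X -> \bar R, (forall n, nnmeas (f_ n)) ->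
    (forall x, {homo f_^~ x : n m / (n <= m)%N >-> n <= m}) ->
    J (fun x => limn (f_^~ x)) = limn (fun n => J (f_ n)) }.

Lemma nnmeas_indic (A : set X) : measurable A -> nnmeas (fun x => (\1_A x)%:E).
Proof. by move=> mA; split => [x|]; [rewrite lee_fin|apply/measurable_EFinP]. Qed.

Lemma nnmeasD f g : nnmeas f -> nnmeas g -> nnmeas (fun x => f x + g x).
Proof. by move=> [f0 mf] [g0 mg]; split => [x|]; [exact: adde_ge0|exact: emeasurable_funD]. Qed.

Lemma nnmeasM f g : nnmeas f -> nnmeas g -> nnmeas (fun x => f x * g x).
Proof. by move=> [f0 mf] [g0 mg]; split => [x|]; [exact: mule_ge0|exact: emeasurable_funM]. Qed.

Lemma nnmeas_cst (c : \bar R) : 0 <= c -> nnmeas (fun=> c).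
Proof. by move=> c0; split. Qed.

Section unique.
Variables (J1 J2 : (X -> \bar R) -> \bar R).
Hypotheses (HJ1 : integral_like J1) (HJ2 : integral_like J2).

Lemma integral_like_sum (I : Type) (s : seq I) (f_ : I -> X -> \bar R) :
  (forall k, nnmeas (f_ k)) -> (forall k, J1 (f_ k) = J2 (f_ k)) ->
  nnmeas (fun x => \sum_(k <- s) f_ k x) /\
  J1 (fun x => \sum_(k <- s) f_ k x) = J2 (fun x => \sum_(k <- s) f_ k x).
Proof.
move=> nf Ef; elim: s => [|a s [IH1 IH2]].
  under eq_fun do rewrite big_nil.
  split; first exact: nnmeas_cst.
  have h J : integral_like J -> J (fun=> 0) = 0.
    move=> HJ; have := @integral_likeZ J HJ 0%R (fun=> 0) (lexx _) (nnmeas_cst (lexx _)).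
    by under eq_fun do rewrite mul0e; rewrite mul0e.
  by rewrite !h.
under eq_fun do rewrite big_cons.
by split; [exact: nnmeasD|rewrite !integral_likeD // IH2 Ef].
Qed.

Lemma integral_like_series (f_ : nat -> X -> \bar R) : (forall k, nnmeas (f_ k)) ->
  (forall k, J1 (f_ k) = J2 (f_ k)) ->
  J1 (fun x => limn (fun n => \sum_(0 <= k < n) f_ k x)) =
  J2 (fun x => limn (fun n => \sum_(0 <= k < n) f_ k x)).
Proof.
move=> nf Ef; have h n := integral_like_sum (index_iota 0 n) nf Ef.
rewrite !(@integral_like_lim _ _ (fun n x => \sum_(0 <= k < n) f_ k x)) //.
- by congr (limn _); apply/funext => n; have [_ ->] := h n.
- by move=> n; have [] := h n.
- by move=> x; apply: ereal_nondecreasing_series => k _ _; have [] := nf k.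
- by move=> n; have [] := h n.
- by move=> x; apply: ereal_nondecreasing_series => k _ _; have [] := nf k.
Qed.

(** Dynkin's pi-lambda argument. The complement step subtracts from the total mass, whence the
    finiteness assumption. *)
Lemma integral_like_indic_unique (G : set (set X)) :
  measurable = <<s G>> -> setI_closed G ->
  J1 (fun=> 1) = J2 (fun=> 1) -> J1 (fun=> 1) < +oo ->
  (forall A, G A -> J1 (fun x => (\1_A x)%:E) = J2 (fun x => (\1_A x)%:E)) ->
  forall A, measurable A -> J1 (fun x => (\1_A x)%:E) = J2 (fun x => (\1_A x)%:E).
Proof.
move=> sG GI J11 J1oo EG A; rewrite sG; move: A; apply: (dynkin_induction (G := G)) => //.
- by under eq_fun do rewrite indicT.
- move=> S mS ES; have mCS := measurableC mS.
  have h J : integral_like J -> J (fun=> 1) = J (fun x => (\1_S x)%:E) + J (fun x => (\1_(~` S) x)%:E).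
    move=> HJ; rewrite -integral_likeD //; try exact: nnmeas_indic.
    congr J; apply/funext => x; rewrite -EFinD !indicE in_setC.
    by case: (x \in S); rewrite ?addr0 ?add0r.
  have := integral_like_ge0 HJ2 (nnmeas_indic mS).
  have := integral_like_ge0 HJ1 (nnmeas_indic mCS).
  have := integral_like_ge0 HJ2 (nnmeas_indic mCS).
  move: (J11) J1oo; rewrite (h J1) // (h J2) // ES.
  case: (J2 _) => [a||]; case: (J1 _) => [b||]; case: (J2 _) => [e||] //= [] Ec //.
  by move=> _ _ _ _; congr _%:E; apply: (addrI a).
- move=> F mF tF EF.
  (* An indicator evaluated at [x] is the Dirac mass at [x], so the pointwise series is its
     countable additivity. *)
  have E x : (\1_(\bigcup_k F k) x)%:E = limn (fun n => \sum_(0 <= k < n) (\1_(F k) x)%:E) :> \bar R.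
    have := measure_semi_bigcup (dirac x : measure X R) mF tF (bigcupT_measurable F mF).
    by rewrite /= /dirac => ->.
  have -> := funext E.
  by apply: integral_like_series => // k; exact: nnmeas_indic.
Qed.

Lemma integral_like_unique (G : set (set X)) :
  measurable = <<s G>> -> setI_closed G ->
  J1 (fun=> 1) = J2 (fun=> 1) -> J1 (fun=> 1) < +oo ->
  (forall A, G A -> J1 (fun x => (\1_A x)%:E) = J2 (fun x => (\1_A x)%:E)) ->
  forall f, nnmeas f -> J1 f = J2 f.
Proof.
move=> sG GI J11 J1oo EG f [f0 mf].
have Ei := integral_like_indic_unique sG GI J11 J1oo EG.
pose h := nnsfun_approx (measurableT : measurable [set: X]) mf.
have fE : f = fun x => limn (fun n => (h n x)%:E).
  apply/funext => x; apply/esym/cvg_lim => //.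
  exact: (cvg_nnsfun_approx measurableT mf).
have nh n : nnmeas (fun x => (h n x)%:E).
  by split=> [x|]; [rewrite lee_fin|apply/measurable_EFinP].
have Eh n : J1 (fun x => (h n x)%:E) = J2 (fun x => (h n x)%:E).
  (* The absolute value makes every coefficient nonnegative, including at reals outside the range of
     [h n], as [integral_like_sum] asks of all indices; on the range it changes nothing. *)
  have hE : (fun x => (h n x)%:E) = fun x => \sum_(y <- finmap.enum_fset (fset_set (range (h n))))
      `|y|%:E * (\1_(h n @^-1` [set y]) x)%:E.
    apply/funext => x; rewrite fimfunE -fsumEFin // fsbig_finite //=.
    rewrite [LHS]big_seq [RHS]big_seq; apply: eq_bigr => y.
    by rewrite in_fset_set // inE => -[z _ <-]; rewrite EFinM ger0_norm.
  have nI y : nnmeas (fun x => (\1_(h n @^-1` [set y]) x)%:E) by exact: nnmeas_indic.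
  rewrite hE; apply: (integral_like_sum _ _ _).2 => y.
    by apply: nnmeasM => //; exact: nnmeas_cst.
  by rewrite !integral_likeZ // Ei.
rewrite fE !(@integral_like_lim _ _ (fun n x => (h n x)%:E)) //.
- by congr (limn _); apply/funext.
- by move=> x a b ab; rewrite lee_fin; apply/lefP/nd_nnsfun_approx.
- by move=> x a b ab; rewrite lee_fin; apply/lefP/nd_nnsfun_approx.
Qed.

End unique.
End integral_like.

Section integral_like_instances.
Context {d d' : measure_display} {Omega : measurableType d} {X : measurableType d'} {R : realType}.
Variable P : {measure set Omega -> \bar R}.
Local Open Scope ereal_scope.

Lemma nnmeas_comp (phi : Omega -> X) f : measurable_fun setT phi -> nnmeas f ->
  nnmeas (R := R) (fun w => f (phi w)).
Proof. by move=> mphi [f0 mf]; split => [//|]; apply: measurableT_comp mf mphi. Qed.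

Lemma integral_like_density (phi : Omega -> X) (H : Omega -> \bar R) :
  measurable_fun setT phi -> nnmeas H -> (forall w, H w \is a fin_num) ->
  integral_like (fun f : X -> \bar R => \int[P]_w (f (phi w) * H w)).
Proof.
move=> mphi nH fH.
have nn f : nnmeas f -> nnmeas (fun w => f (phi w) * H w).
  by move=> nf; apply: nnmeasM => //; exact: nnmeas_comp.
split.
- by move=> f /nn[f0 _]; apply: integral_ge0.
- move=> c f c0 /nn[f0 mf]; rewrite -ge0_integralZl_EFin //.
  by apply: eq_integral => w _; rewrite muleA.
- move=> f g nf ng; rewrite -ge0_integralD //; try by have [] := nn _ nf.
    by apply: eq_integral => w _; rewrite ge0_muleDl //; [case: nf|case: ng].
  by have [] := nn _ ng.
  by have [] := nn _ ng.
- move=> f_ nf ndf; rewrite -monotone_convergence //.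
  + apply: eq_integral => w _; have [H0 _] := nH.
    have cf : f_^~ (phi w) @ \oo --> limn (f_^~ (phi w)).
      exact: ereal_nondecreasing_is_cvgn.
    by apply/esym/cvg_lim => //; exact: cvgeZr.
  + by move=> n; have [] := nn _ (nf n).
  + by move=> n w _; have [] := nn _ (nf n).
  + by move=> w _ a b ab; apply: lee_wpmul2r; [case: nH|exact: ndf].
Qed.

End integral_like_instances.

Section probability_kernel.
Context {d d' : measure_display} {Y : measurableType d} {Z : measurableType d'} {R : realType}.
Variable l : Y -> probability Z R.
(** The measurability proof is a parameter so that the kernel instances below can be attached to
    this name. They supply the measurability of integrals over one coordinate of a jointly
    measurable function. *)
Definition kernel_of_probability
    of (forall U, measurable U -> measurable_fun setT (fun y => l y U)) :
  Y -> {measure set Z -> \bar R} := l.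
Hypothesis ml : forall U, measurable U -> measurable_fun setT (fun y => l y U).

HB.instance Definition _ := @isKernel.Build _ _ Y Z R (kernel_of_probability ml) ml.

Let kernel_of_probability_setT y : kernel_of_probability ml y setT = 1%E.
Proof. exact: probability_setT. Qed.

HB.instance Definition _ := @Kernel_isProbability.Build _ _ Y Z R
  (kernel_of_probability ml) kernel_of_probability_setT.
End probability_kernel.

Section integral_like_mixture.
Context {d d1 d2 : measure_display} {Omega : measurableType d} {Y : measurableType d1}
  {Z : measurableType d2} {R : realType}.
Variables (P : {measure set Omega -> \bar R}) (l : Y -> probability Z R).
Local Open Scope ereal_scope.
Hypothesis ml : forall U, measurable U -> measurable_fun setT (fun y => l y U).

Lemma nnmeas_integral (h : Y * Z -> \bar R) : nnmeas h ->
  nnmeas (fun y => \int[l y]_z h (y, z)).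
Proof.
move=> [h0 mh]; split; first by move=> y; apply: integral_ge0.
exact: (@measurable_fun_integral_finite_kernel _ _ _ _ _ _ (kernel_of_probability ml) h0 mh).
Qed.

Lemma nnmeas_section (h : Y * Z -> \bar R) y : nnmeas h -> nnmeas (fun z => h (y, z)).
Proof. by move=> [h0 mh]; split=> //; apply: measurableT_comp mh (pair1_measurable y). Qed.

Lemma integral_like_mixture (phi : Omega -> Y) : measurable_fun setT phi ->
  integral_like (fun h : Y * Z -> \bar R => \int[P]_w \int[l (phi w)]_z h (phi w, z)).
Proof.
move=> mphi.
have nn h : nnmeas h -> nnmeas (fun w => \int[l (phi w)]_z h (phi w, z)).
  by move=> /nnmeas_integral nh; exact: (nnmeas_comp mphi nh).
split.
- by move=> h /nn[h0 _]; apply: integral_ge0.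
- move=> c h c0 nh; rewrite -ge0_integralZl_EFin //; try by have [] := nn _ nh.
  apply: eq_integral => w _; have [h0 mh] := nnmeas_section (phi w) nh.
  by rewrite ge0_integralZl_EFin.
- move=> f g nf ng; rewrite -ge0_integralD //; try by have [] := nn _ nf.
  + apply: eq_integral => w _; have [f0 mf] := nnmeas_section (phi w) nf.
    by have [g0 mg] := nnmeas_section (phi w) ng; rewrite ge0_integralD.
  + by have [] := nn _ ng.
  + by have [] := nn _ ng.
- move=> f_ nf ndf; have ns n w := nnmeas_section (phi w) (nf n).
  rewrite -monotone_convergence //.
  + apply: eq_integral => w _; rewrite monotone_convergence //.
    * by move=> n; have [] := ns n w.
    * by move=> n z _; have [] := ns n w.
  + by move=> n; have [] := nn _ (nf n).
  + by move=> n w _; have [] := nn _ (nf n).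
  + move=> w _ a b ab; apply: ge0_le_integral => //.
    * by move=> z _; have [] := ns a w.
    * by have [] := ns a w.
    * by have [] := ns b w.
    * by move=> z _; exact: ndf.
Qed.

End integral_like_mixture.

(** * The filtration generated by the regressors and the past errors *)

Section cond_iid_theory.
Context {R : realType} {d : measure_display} {Omega : measurableType d}.
Variables (P : probability Omega R) (m n T : nat) (Xt : Omega -> 'M[R]_(m, n)).
Variables (eps : 'I_T.+1 -> Omega -> R) (q : Omega -> probability R R).
Hypothesis mXt : forall i j, measurable_fun setT (fun w => Xt w i j).
Hypothesis meps : forall j, measurable_fun setT (eps j).
Hypothesis Hiid : cond_iid P Xt eps q.

Definition entry_preimages : set (set Omega) :=
  [set A | exists i j (B : set R), measurable B /\ A = (fun w => Xt w i j) @^-1` B].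

Definition rect (B : 'I_T.+1 -> set R) : set Omega :=
  \big[setI/setT]_(i < T.+1) (eps i @^-1` B i).

(* pi-system generating the sigma-algebra of [Xt] and of the [eps i] with [i < k] *)
Definition past_rects (k : nat) : set (set Omega) := [set S | exists A B,
  [/\ sigmaX Xt A, (forall i, measurable (B i)),
      (forall i : 'I_T.+1, (k <= i)%N -> B i = setT) & S = A `&` rect B]].

Notation OmegaX := (g_sigma_algebraType entry_preimages).
Notation Past k := (g_sigma_algebraType (past_rects k)).

Lemma sigmaX_measurable A : sigmaX Xt A -> measurable A.
Proof.
move: A; apply: smallest_sub; first exact: sigma_algebra_measurable.
by move=> _ [i [j [B [mB ->]]]]; rewrite -[X in measurable X]setTI; exact: mXt.
Qed.

Lemma rect_measurable B : (forall i, measurable (B i)) -> measurable (rect B).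
Proof.
move=> mB; apply: bigsetI_measurable => i _.
by rewrite -[X in measurable X]setTI; exact: meps.
Qed.

Lemma rectE B w : rect B w <-> forall i, B i (eps i w).
Proof.
split=> [h i|h].
  by move: h; rewrite /rect (bigD1 i) //= => -[].
by rewrite /rect; elim/big_ind: _ => // i _; exact: h.
Qed.

Lemma rectI B B' : rect B `&` rect B' = rect (fun i => B i `&` B' i).
Proof.
apply/seteqP; split=> w; first by move=> [/rectE h /rectE h']; apply/rectE => i; split.
by move=> /rectE h; split; apply/rectE => i; case: (h i).
Qed.

Lemma past_rects_measurable k S : past_rects k S -> measurable S.
Proof.
move=> [A [B [sA mB _ ->]]]; apply: measurableI; last exact: rect_measurable.
exact: sigmaX_measurable.
Qed.

Lemma past_measurable k S : <<s past_rects k >> S -> measurable S.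
Proof.
move: S; apply: smallest_sub; first exact: sigma_algebra_measurable.
exact: past_rects_measurable.
Qed.

Lemma sigmaX_past k A : sigmaX Xt A -> <<s past_rects k >> A.
Proof.
move=> sA; apply: sub_sigma_algebra; exists A, (fun=> setT); split => //.
by rewrite (_ : rect _ = setT) ?setIT //; apply/seteqP; split=> // w _; apply/rectE.
Qed.

Lemma past_rectsS k k' : (k <= k')%N -> <<s past_rects k >> `<=` <<s past_rects k' >>.
Proof.
move=> kk'; apply: sub_sigma_algebra2 => _ [A [B [sA mB BT ->]]].
by exists A, B; split => // i k'i; apply: BT; exact: leq_trans kk' k'i.
Qed.

Lemma id_past_measurable k : measurable_fun setT (id : Omega -> Past k).
Proof. by move=> _ Y mY; rewrite setTI; apply: (@past_measurable k). Qed.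

Lemma id_sigmaX_measurable : measurable_fun setT (id : Omega -> OmegaX).
Proof. by move=> _ Y mY; rewrite setTI; exact: sigmaX_measurable. Qed.

Lemma id_past_le k k' : (k <= k')%N -> measurable_fun setT (id : Past k' -> Past k).
Proof. by move=> kk' _ Y mY; rewrite setTI; apply: past_rectsS mY. Qed.

Lemma id_past_sigmaX k : measurable_fun setT (id : Past k -> OmegaX).
Proof. by move=> _ Y mY; rewrite setTI; exact: sigmaX_past. Qed.

Lemma q_sigmaX_measurable B : measurable B ->
  measurable_fun setT (fun w : OmegaX => q w B).
Proof.
move=> mB; have -> : (fun w : OmegaX => q w B) = (fun w => (fine (q w B))%:E).
  by apply/funext => w; rewrite fineK // fin_num_measure.
by apply/measurable_EFinP => _ Y mY; rewrite setTI; exact: (Hiid.1 _ mB _ mY).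
Qed.

Lemma q_past_measurable k B : measurable B ->
  measurable_fun setT (fun w : Past k => q w B).
Proof.
by move=> mB; exact: (measurableT_comp (q_sigmaX_measurable mB) (@id_past_sigmaX k)).
Qed.

Lemma eps_past_measurable k (i : 'I_T.+1) : (i < k)%N ->
  measurable_fun setT (eps i : Past k -> R).
Proof.
move=> ik _ Y mY; rewrite setTI; apply: sub_sigma_algebra.
exists setT, (fun i' => if i' == i then Y else setT); split.
- exact: (@measurableT _ OmegaX).
- by move=> i'; case: ifP.
- by move=> i' ki'; case: eqP => // ii'; move: ik; rewrite ltnNge -ii' ki'.
- rewrite setTI; apply/seteqP; split=> w.
    by move=> /= Yw; apply/rectE => i'; case: eqP => // ->.
  by move=> /rectE /(_ i); rewrite eqxx.
Qed.

Lemma indicX (U V : Type) (S : set U) (B : set V) x y :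
  \1_(S `*` B) (x, y) = \1_S x * \1_B y :> R.
Proof. by rewrite !indicE in_setX -natrM mulnb. Qed.

Lemma mulindic (U : Type) (S S' : set U) x : \1_(S `&` S') x = \1_S x * \1_S' x :> R.
Proof. by rewrite indicI. Qed.

(** Conditional independence is assumed for indicators of events of sigma(X~); uniqueness, with all
    of sigma(X~) as the pi-system, extends it to nonnegative weights [g]. *)
Lemma past_integral_rect B (g : OmegaX -> \bar R) : (forall i, measurable (B i)) -> nnmeas g ->
  (\int[P]_w (g w * (\1_(rect B) w)%:E) = \int[P]_w (g w * \prod_(i < T.+1) q w (B i)))%E.
Proof.
move=> mB ng.
have fprod w : (\prod_(i < T.+1) q w (B i))%E \is a fin_num.
  by elim/big_ind: _ => // [x y|i _]; [exact: fin_numM|exact: fin_num_measure].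
have nprod : nnmeas (fun w : Omega => (\prod_(i < T.+1) q w (B i))%E).
  elim: (index_enum _) => [|i s IH].
    by under eq_fun do rewrite big_nil; exact: nnmeas_cst.
  under eq_fun do rewrite big_cons; apply: nnmeasM => //; split => //.
  exact: (measurableT_comp (q_sigmaX_measurable (mB i)) id_sigmaX_measurable).
have mr := rect_measurable mB.
have L1 := integral_like_density P id_sigmaX_measurable (nnmeas_indic mr) (fun w => erefl).
have L2 := integral_like_density P id_sigmaX_measurable nprod fprod.
have E A : sigmaX Xt A -> (\int[P]_w ((\1_A w)%:E * (\1_(rect B) w)%:E) =
    \int[P]_w ((\1_A w)%:E * \prod_(i < T.+1) q w (B i)))%E.
  move=> sA; have mA := sigmaX_measurable sA.
  transitivity (P (A `&` rect B)).
    rewrite -[in RHS](setIT (_ `&` _)) -integral_indic //; last exact: measurableI.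
    by apply: eq_integral => w _; rewrite indicI.
  rewrite (Hiid.2 _ sA _ mB) integral_mkcond epatch_indic; apply: eq_integral => w _ /=.
  by rewrite muleC.
apply: (integral_like_unique L1 L2 (G := measurable)) => //.
- by rewrite smallest_id //; exact: sigma_algebra_measurable.
- by move=> A A'; exact: measurableI.
- by have := E setT (@measurableT _ OmegaX); rewrite indicT.
- under eq_integral do rewrite mul1e; rewrite integral_indic // setIT.
  by rewrite -ge0_fin_numE // fin_num_measure.
Qed.

(* [q] is the conditional law of [eps j] given [Xt] and the earlier errors. *)
Lemma past_integral_prod (j : 'I_T.+1) (h : Past j * R -> \bar R) : nnmeas h ->
  (\int[P]_w h (w, eps j w) = \int[P]_w \int[q w]_x h (w, x))%E.
Proof.
move=> nh.
have mphi : measurable_fun setT (fun w : Omega => (w, eps j w) : Past j * R).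
  by apply: measurable_fun_pair => //; exact: id_past_measurable.
have L1 := integral_like_density P mphi (nnmeas_cst lee01) (fun w => erefl).
have L2 := integral_like_mixture P (@q_past_measurable j) (@id_past_measurable j).
transitivity (\int[P]_w (h (w, eps j w) * 1))%E.
  by apply: eq_integral => w _; rewrite mule1.
apply: (integral_like_unique L1 L2 (G := _)) nh.
- exact: measurable_prod_measurableType.
- move=> _ _ [A1 mA1 [A2 mA2 <-]] [B1 mB1 [B2 mB2 <-]].
  exists (A1 `&` B1); first exact: measurableI.
  by exists (A2 `&` B2); [exact: measurableI|rewrite setXI].
- apply: eq_integral => w _; rewrite mul1e integral_cst // mul1e; exact/esym/probability_setT.
- by under eq_integral do rewrite mul1e; rewrite integral_cst // mul1e; apply: (le_lt_trans (probability_le1 _ _)) => //; exact: ltry.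
(* With [B] fixed, both sides are integral-like in the indicator of [S], so a second pi-lambda
   argument, now over [past_rects j], reduces [S] to a rectangle. *)
move=> _ [S mS [B mB <-]].
have nqB : nnmeas (fun w : Omega => q w B).
  by split=> //; exact: (measurableT_comp (q_sigmaX_measurable mB) id_sigmaX_measurable).
have mpB : measurable (eps j @^-1` B) by rewrite -[X in measurable X]setTI; exact: meps.
transitivity (\int[P]_w ((\1_S w)%:E * (\1_(eps j @^-1` B) w)%:E))%E.
  by apply: eq_integral => w _; rewrite mule1 -EFinM indicX.
transitivity (\int[P]_w ((\1_S w)%:E * q w B))%E; last first.
  apply: eq_integral => w _; rewrite -[in LHS](setIT B) -integral_indic // -ge0_integralZl_EFin //.
    by apply: eq_integral => x _; rewrite -EFinM indicX.
  exact/measurable_EFinP.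
have L3 := integral_like_density P (@id_past_measurable j) (nnmeas_indic mpB) (fun w => erefl).
have L4 := integral_like_density P (@id_past_measurable j) nqB (fun w => fin_num_measure _ _ mB).
have EG A : past_rects j A -> (\int[P]_w ((\1_A w)%:E * (\1_(eps j @^-1` B) w)%:E) =
   \int[P]_w ((\1_A w)%:E * q w B))%E.
  move=> [A0 [C [sA mC CT ->]]].
  (* A past rectangle leaves coordinate [j] free, so the event on [eps j] is inserted there. In the
     product of conditional probabilities the factor of [setT], equal to 1, becomes [q w B], which
     can be moved into the weight [g]. *)
  pose C' i := if i == j then B else C i.
  have mC' i : measurable (C' i) by rewrite /C'; case: ifP.
  have nA0 : nnmeas (fun w : OmegaX => (\1_A0 w)%:E : \bar R) by exact: nnmeas_indic.
  have Cj : C j = setT by apply: CT.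
  transitivity (\int[P]_w ((\1_A0 w)%:E * (\1_(rect C') w)%:E))%E.
    apply: eq_integral => w _; rewrite -!EFinM -!mulindic; congr (\1_ _ _)%:E.
    rewrite -setIA; congr (_ `&` _); apply/seteqP; split=> v.
      by move=> [/rectE Cv Bv]; apply/rectE => i; rewrite /C'; case: eqP => // ->.
    move=> /rectE Cv; split; last by have := Cv j; rewrite /C' eqxx.
    by apply/rectE => i; have := Cv i; rewrite /C'; case: eqP => // ->; rewrite Cj.
  rewrite past_integral_rect //.
  transitivity (\int[P]_w ((\1_A0 w)%:E * q w B * (\1_(rect C) w)%:E))%E; last first.
    by apply: eq_integral => w _; rewrite muleAC -EFinM -mulindic.
  rewrite past_integral_rect //; last first.
    by apply: nnmeasM => //; split=> //; exact: q_sigmaX_measurable.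
  apply: eq_integral => w _; rewrite -muleA; congr (_ * _)%E.
  rewrite (bigD1 j) //= [in RHS](bigD1 j) //= {1}/C' eqxx Cj probability_setT mul1e.
  by congr (_ * _)%E; apply: eq_bigr => i /negbTE ij; rewrite /C' ij.
apply: (integral_like_indic_unique L3 L4 (G := past_rects j)) => //.
- move=> _ _ [A [B1 [sA mB1 BT ->]]] [A' [B' [sA' mB' BT' ->]]].
  exists (A `&` A'), (fun i => B1 i `&` B' i); split.
  + exact: (@measurableI _ OmegaX).
  + by move=> i; exact: measurableI.
  + by move=> i ji; rewrite BT // BT' // setIT.
  + by rewrite -rectI setIACA.
- have := EG setT; rewrite indicT; apply; exists setT, (fun=> setT); split => //.
    exact: (@measurableT _ OmegaX).
  by rewrite setTI; apply/seteqP; split=> // w _; apply/rectE.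
- under eq_integral do rewrite mul1e; rewrite integral_indic // setIT.
  by rewrite -ge0_fin_numE // fin_num_measure.
Qed.

End cond_iid_theory.

(** * Second-moment bounds *)

Section second_moments.
Context {R : realType} {d : measure_display} {Omega : measurableType d}.
Variables (P : probability Omega R) (m n T : nat) (Xt : Omega -> 'M[R]_(m, n)).
Variables (eps : 'I_T.+1 -> Omega -> R) (q : Omega -> probability R R).
Hypothesis mXt : forall i j, measurable_fun setT (fun w => Xt w i j).
Hypothesis meps : forall j, measurable_fun setT (eps j).
Hypothesis Hiid : cond_iid P Xt eps q.
Notation OmegaX := (g_sigma_algebraType (entry_preimages Xt)).
Notation Past k := (g_sigma_algebraType (past_rects Xt eps k)).

Lemma past_measurable_id k (f : Omega -> R) :
  measurable_fun setT (f : Past k -> R) -> measurable_fun setT f.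
Proof. by move=> mf; have h := measurableT_comp mf (@id_past_measurable _ _ _ _ _ _ _ _ mXt meps k); exact: h. Qed.

Lemma past_measurable_le k k' (f : Omega -> R) : (k <= k')%N ->
  measurable_fun setT (f : Past k -> R) -> measurable_fun setT (f : Past k' -> R).
Proof. by move=> kk' mf; have h := measurableT_comp mf (@id_past_le _ _ _ _ _ _ Xt eps k k' kk'); exact: h. Qed.

Lemma sigmaX_past_measurable k (f : Omega -> R) :
  measurable_fun setT (f : OmegaX -> R) -> measurable_fun setT (f : Past k -> R).
Proof. by move=> mf; have h := measurableT_comp mf (@id_past_sigmaX _ _ _ _ _ _ Xt eps k); exact: h. Qed.

Section martingale.
Variables (H : 'I_T.+1 -> Omega -> R) (phi : Omega -> R -> R) (D : R).
Hypothesis D0 : 0 <= D.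
Hypothesis mH : forall j : 'I_T.+1, measurable_fun setT (H j : Past j -> R).
Hypothesis mphi : measurable_fun setT (fun z : OmegaX * R => phi z.1 z.2).
Hypothesis phi2 : {ae P, forall w, forall a b,
  (\int[q w]_x (((a + b * phi w x) ^+ 2)%:E) <= (a ^+ 2 + D * b ^+ 2)%:E)%E}.

Let S k w := \sum_(i < T.+1 | (i < k)%N) H i w * phi w (eps i w).

Let mphi_eps k (i : 'I_T.+1) : (i < k)%N ->
  measurable_fun setT (fun w : Past k => phi w (eps i w)).
Proof.
move=> ik.
have mp : measurable_fun setT (fun w : Past k => (w, eps i w) : OmegaX * R).
  apply: measurable_fun_pair; first exact: id_past_sigmaX.
  exact: eps_past_measurable.
exact: (measurableT_comp mphi mp).
Qed.

Let mS k : measurable_fun setT (S k : Past k -> R).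
Proof.
have -> : S k = fun w => \sum_(i < T.+1) if (i < k)%N then H i w * phi w (eps i w) else 0.
  by apply/funext => w; rewrite /S [LHS]big_mkcond.
apply: measurable_sum => i; case ik: (i < k)%N => //; apply: measurable_funM; last exact: mphi_eps.
exact: (@past_measurable_le i k (H i) (ltnW ik) (@mH i)).
Qed.

Let mH2 (i : 'I_T.+1) : measurable_fun setT (fun w => H i w ^+ 2).
Proof. by apply: measurable_funX; exact: (@past_measurable_id i (H i) (@mH i)). Qed.

Let mS2 k : measurable_fun setT (fun w => S k w ^+ 2).
Proof. by apply: measurable_funX; exact: (@past_measurable_id k (S k) (@mS k)). Qed.

Let msum k : measurable_fun setT (fun w => D * \sum_(i < T.+1 | (i < k)%N) H i w ^+ 2).
Proof.
apply: measurable_funM => //; have -> : (fun w => \sum_(i < T.+1 | (i < k)%N) H i w ^+ 2) =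
    fun w => \sum_(i < T.+1) if (i < k)%N then H i w ^+ 2 else 0.
  by apply/funext => w; rewrite [LHS]big_mkcond.
by apply: measurable_sum => i; case: (i < k)%N.
Qed.

Let sum_ge0 k w : 0 <= D * \sum_(i < T.+1 | (i < k)%N) H i w ^+ 2.
Proof. by rewrite mulr_ge0 // sumr_ge0 // => i _; rewrite sqr_ge0. Qed.

Let S_recr k (kT : (k < T.+1)%N) w :
  S k.+1 w = S k w + H (Ordinal kT) w * phi w (eps (Ordinal kT) w).
Proof.
rewrite /S (bigD1 (Ordinal kT)) //= addrC; congr (_ + _); apply: eq_bigl => i.
by rewrite ltnS -val_eqE /= [RHS]ltn_neqAle andbC.
Qed.

(* Integrating the square over [eps k] with the past frozen makes the cross term vanish pointwise,
   so no integrability of the partial sums is needed. *)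
Let martingale_second_moment_lt k : (k <= T.+1)%N ->
  (\int[P]_w ((S k w) ^+ 2)%:E <=
   \int[P]_w (D * \sum_(i < T.+1 | (i < k)%N) H i w ^+ 2)%:E)%E.
Proof.
elim: k => [_|k IH kT].
  apply: ge0_le_integral => //.
  - by move=> w _; rewrite lee_fin sqr_ge0.
  - exact/measurable_EFinP.
  - exact/measurable_EFinP.
  - by move=> w _; rewrite /S !big_pred0 // expr0n mulr0.
pose j := Ordinal kT.
pose h (z : Past j * R) := ((S k z.1 + H j z.1 * phi z.1 z.2) ^+ 2)%:E.
have nh : nnmeas h.
  split=> [z|]; first by rewrite lee_fin sqr_ge0.
  apply/measurable_EFinP; apply: measurable_funX; apply: measurable_funD.
    have h1 := measurableT_comp (@mS k) (@measurable_fst _ _ (Past j) R); exact: h1.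
  apply: measurable_funM.
    have h1 := measurableT_comp (@mH j) (@measurable_fst _ _ (Past j) R); exact: h1.
  have mp : measurable_fun setT (fun z : Past j * R => (z.1, z.2) : OmegaX * R).
    apply: measurable_fun_pair => //.
    have h1 := measurableT_comp (@id_past_sigmaX _ _ _ _ _ _ Xt eps j) (@measurable_fst _ _ (Past j) R).
    exact: h1.
  have h1 := measurableT_comp mphi mp; exact: h1.
have -> : (\int[P]_w ((S k.+1 w) ^+ 2)%:E =
    \int[P]_w \int[q w]_x ((S k w + H j w * phi w x) ^+ 2)%:E)%E.
  rewrite -(past_integral_prod mXt meps Hiid (j := j) (h := h)) //.
  by apply: eq_integral => w _; rewrite S_recr.
apply: (@le_trans _ _ (\int[P]_w ((S k w) ^+ 2 + D * H j w ^+ 2)%:E)%E).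
  apply: ae_ge0_le_integral => //.
  - by move=> w _; apply: integral_ge0 => x _; rewrite lee_fin sqr_ge0.
  - have [_ h1] := nnmeas_integral (@q_past_measurable _ _ _ _ _ _ _ _ _ _ Hiid j) nh.
    have h2 := measurableT_comp h1 (@id_past_measurable _ _ _ _ _ _ _ _ mXt meps j); exact: h2.
  - by move=> w _; rewrite lee_fin; apply: addr_ge0; [exact: sqr_ge0|apply: mulr_ge0 => //; exact: sqr_ge0].
  - by apply/measurable_EFinP; apply: measurable_funD => //; exact: measurable_funM.
  - by apply: filterS phi2 => w + _; apply.
under eq_integral do rewrite EFinD.
rewrite ge0_integralD //; last 4 first.
- by move=> w _; rewrite lee_fin sqr_ge0.
- exact/measurable_EFinP.
- by move=> w _; rewrite lee_fin; apply: mulr_ge0 => //; exact: sqr_ge0.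
- by apply/measurable_EFinP; exact: measurable_funM.
apply: (le_trans (leeD2r _ (IH (ltnW kT)))).
rewrite -ge0_integralD //; last 4 first.
- by move=> w _; rewrite lee_fin.
- exact/measurable_EFinP.
- by move=> w _; rewrite lee_fin; apply: mulr_ge0 => //; exact: sqr_ge0.
- by apply/measurable_EFinP; exact: measurable_funM.
rewrite le_eqVlt; apply/orP; left; apply/eqP; apply: eq_integral => w _.
rewrite -EFinD -mulrDr; congr (_ * _)%:E.
rewrite [in RHS](bigD1 j) //= addrC; congr (_ + _); apply: eq_bigl => i.
by rewrite ltnS -val_eqE /= [LHS]ltn_neqAle andbC.
Qed.

Lemma martingale_second_moment :
  (\int[P]_w ((\sum_i H i w * phi w (eps i w)) ^+ 2)%:E <=
   \int[P]_w (D * \sum_i H i w ^+ 2)%:E)%E.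
Proof.
have := martingale_second_moment_lt (leqnn _).
rewrite /S; under eq_integral do under eq_bigl do rewrite ltn_ord.
by under [X in (_ <= X)%E]eq_integral do under eq_bigl do rewrite ltn_ord.
Qed.
End martingale.
End second_moments.

(** Supplies [phi2]. Integrability of [f] comes from |f| <= 1 + f^2, so the cross term exists and
    vanishes. *)
Lemma integral_affine_sqr (R : realType) (mu : probability R R) (f : R -> R) (D a b : R) :
  measurable_fun setT f -> (\int[mu]_x (f x)%:E = 0)%E ->
  (\int[mu]_x ((f x) ^+ 2)%:E <= D%:E)%E ->
  (\int[mu]_x ((a + b * f x) ^+ 2)%:E <= (a ^+ 2 + D * b ^+ 2)%:E)%E.
Proof.
move=> mf f0 f2.
have mf2 : measurable_fun setT (fun x => f x ^+ 2) by exact: measurable_funX.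
have if2 : mu.-integrable setT (fun x => (f x ^+ 2)%:E).
  apply/integrableP; split; first exact/measurable_EFinP.
  under eq_integral do rewrite gee0_abs ?lee_fin ?sqr_ge0 //.
  exact: le_lt_trans f2 (ltry _).
have i1 : mu.-integrable setT (fun=> 1%:E) by exact: (finite_measure_integrable_cst mu 1).
have if1 : mu.-integrable setT (fun x => (f x)%:E).
  apply: (le_integrable _ _ _ (integrableD _ i1 if2)) => //.
    exact/measurable_EFinP.
  move=> x _ /=; rewrite lee_fin [leRHS]ger0_norm ?addr_ge0 ?sqr_ge0 //.
  rewrite -(real_normK (num_real (f x))); move: `|f x| (normr_ge0 (f x)) => y; nra.
have -> : (fun x => ((a + b * f x) ^+ 2)%:E) =
    (fun x => (a ^+ 2)%:E * 1%:E + ((2 * a * b)%:E * (f x)%:E + (b ^+ 2)%:E * (f x ^+ 2)%:E))%E.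
  by apply/funext => x; rewrite -!EFinM -!EFinD; congr _%:E; ring.
rewrite integralD //; last 2 first.
- exact: integrableZl.
- by apply: integrableD => //; exact: integrableZl.
rewrite integralD //; try exact: integrableZl.
rewrite !integralZl // f0 mule0 add0e integral_cst // mul1e [X in (_ * X)%E]probability_setT mule1.
rewrite EFinD leeD2l // [D * _]mulrC (EFinM _ D); apply: lee_wpmul2l => //.
by rewrite lee_fin sqr_ge0.
Qed.

(** * Linear, diagonal and quadratic forms in the errors *)

Section quadratic_forms.
Context {R : realType} {d : measure_display} {Omega : measurableType d}.
Variables (P : probability Omega R) (m n T : nat) (Xt : Omega -> 'M[R]_(m, n)).
Variables (eps : 'I_T.+1 -> Omega -> R) (q : Omega -> probability R R) (C : R).
Hypothesis mXt : forall i j, measurable_fun setT (fun w => Xt w i j).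
Hypothesis meps : forall j, measurable_fun setT (eps j).
Hypothesis Hiid : cond_iid P Xt eps q.
Hypothesis C0 : 0 <= C.
Hypothesis Hmom : {ae P, forall w, (\int[q w]_x (x%:E) = 0)%E /\
  (\int[q w]_x ((x ^+ 2)%:E) <= C%:E)%E /\ (\int[q w]_x ((x ^+ 4)%:E) <= C%:E)%E}.
Notation OmegaX := (g_sigma_algebraType (entry_preimages Xt)).
Notation Past k := (g_sigma_algebraType (past_rects Xt eps k)).

Lemma sigma2_measurable : measurable_fun setT (sigma2 q : OmegaX -> R).
Proof.
have nx2 : nnmeas (fun z : OmegaX * R => (z.2 ^+ 2)%:E : \bar R).
  split=> [z|]; first by rewrite lee_fin sqr_ge0.
  by apply/measurable_EFinP; apply: measurable_funX; exact: measurable_snd.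
have [_ h1] := nnmeas_integral (@q_sigmaX_measurable _ _ _ _ _ _ _ _ _ _ Hiid) nx2.
have h2 := measurableT_comp (fine_measurable measurableT) h1; exact: h2.
Qed.

Lemma sigma2_ge0 w : 0 <= sigma2 q w.
Proof. by apply: fine_ge0; apply: integral_ge0 => x _; rewrite lee_fin sqr_ge0. Qed.

Lemma linear_second_moment (a : 'I_T.+1 -> Omega -> R) :
  (forall j : 'I_T.+1, measurable_fun setT (a j : Past j -> R)) ->
  (\int[P]_w ((\sum_i a i w * eps i w) ^+ 2)%:E <= \int[P]_w (C * \sum_i a i w ^+ 2)%:E)%E.
Proof.
move=> ma; apply: (@martingale_second_moment _ _ _ _ _ _ _ _ _ _ mXt meps Hiid a (fun _ x => x) C) => //; first exact: measurable_snd.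
apply: filterS Hmom => w [h1 [h2 _]] s t; exact: integral_affine_sqr.
Qed.

(** With v = sigma^2, (x^2 - v)^2 <= x^4 + v^2 because v and x^2 are nonnegative; the fourth moment
    and v are both at most [C], which gives [C + C ^+ 2]. *)
Lemma diagonal_second_moment (a : 'I_T.+1 -> Omega -> R) :
  (forall j : 'I_T.+1, measurable_fun setT (a j : Past j -> R)) ->
  (\int[P]_w ((\sum_i a i w * (eps i w ^+ 2 - sigma2 q w)) ^+ 2)%:E <=
   \int[P]_w ((C + C ^+ 2) * \sum_i a i w ^+ 2)%:E)%E.
Proof.
move=> ma.
apply: (@martingale_second_moment _ _ _ _ _ _ _ _ _ _ mXt meps Hiid a
  (fun w x => x ^+ 2 - sigma2 q w) (C + C ^+ 2)) => //.
- by rewrite addr_ge0 // sqr_ge0.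
- apply: measurable_funB; first by apply: measurable_funX; exact: measurable_snd.
  have h2 := measurableT_comp sigma2_measurable (@measurable_fst _ _ OmegaX R); exact: h2.
apply: filterS Hmom => w [_ [h2 h4]] s t.
have s2E : (\int[q w]_x ((x ^+ 2)%:E) = (sigma2 q w)%:E)%E.
  rewrite fineK // ge0_fin_numE; first exact: le_lt_trans h2 (ltry _).
  by apply: integral_ge0 => x _; rewrite lee_fin sqr_ge0.
have s2C : sigma2 q w <= C by rewrite -lee_fin -s2E.
have s20 := sigma2_ge0 w; move: (sigma2 q w) s2E s2C s20 => v s2E s2C s20.
have mX k : measurable_fun setT (fun x : R => x ^+ k) by exact: measurable_funX.
apply: integral_affine_sqr.
- exact: measurable_funB.
- under eq_integral do rewrite EFinB.
  rewrite integralB //; last 2 first.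
  + apply/integrableP; split; first exact/measurable_EFinP.
    under eq_integral do rewrite gee0_abs ?lee_fin ?sqr_ge0 //.
    exact: le_lt_trans h2 (ltry _).
  + exact: (finite_measure_integrable_cst (q w) v).
  by rewrite s2E integral_cst // [X in (_ * X)%E]probability_setT mule1 subee.
apply: (@le_trans _ _ (\int[q w]_x ((x ^+ 4)%:E + (v ^+ 2)%:E))%E).
  apply: ge0_le_integral => //.
  - by move=> x _; rewrite lee_fin sqr_ge0.
  - by apply/measurable_EFinP; apply: measurable_funX; exact: measurable_funB.
  - by apply: emeasurable_funD => //; exact/measurable_EFinP.
  - move=> x _; rewrite -EFinD lee_fin.
    have := sqr_ge0 x; rewrite [x ^+ 4](exprM x 2 2).
    by move: (x ^+ 2) => y; nra.
rewrite ge0_integralD //; last 3 first.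
- by move=> x _; rewrite lee_fin [x ^+ 4](exprM x 2 2) sqr_ge0.
- exact/measurable_EFinP.
- by move=> x _; rewrite lee_fin sqr_ge0.
rewrite integral_cst // [X in (_ * X)%E]probability_setT mule1 EFinD; apply: leeD => //.
by rewrite lee_fin ler_sqr ?nnegrE.
Qed.

(** Each off-diagonal pair is charged to its larger index [j], so that the coefficient of [eps j]
    will involve earlier errors only. *)
Lemma sum_upper_lower (N : nat) (f : 'I_N -> 'I_N -> R) :
  \sum_i \sum_j f i j = \sum_i f i i + \sum_(j < N) \sum_(i < N) (if (i < j)%N then f i j + f j i else 0).
Proof.
have -> : \sum_(j < N) \sum_(i < N) (if (i < j)%N then f i j + f j i else 0) =
    \sum_(j < N) \sum_(i < N) (if (i < j)%N then f i j else 0) + \sum_(j < N) \sum_(i < N) (if (i < j)%N then f j i else 0).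
  rewrite -big_split; apply: eq_bigr => j _; rewrite -big_split; apply: eq_bigr => i _ /=.
  by case: ifP => // _; rewrite addr0.
rewrite [X in _ + (_ + X)]exchange_big -!big_split [LHS]exchange_big.
apply: eq_bigr => j _ /=; rewrite -big_split [LHS](bigD1 j) //= [in RHS](bigD1 j) //= ltnn add0r add0r.
congr (_ + _); apply: eq_bigr => i ij.
by case: ltngtP => [||/val_inj E]; rewrite ?addr0 ?add0r //; move: ij; rewrite E eqxx.
Qed.

Let past_of (f : Omega -> R) : measurable_fun setT (f : OmegaX -> R) ->
  forall j : 'I_T.+1, measurable_fun setT (f : Past j -> R).
Proof. by move=> mf j; exact: (@sigmaX_past_measurable _ _ _ _ _ _ Xt eps j f mf). Qed.

Let of_past (j : 'I_T.+1) (f : Omega -> R) : measurable_fun setT (f : Past j -> R) ->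
  measurable_fun setT f.
Proof. by move=> mf; exact: (@past_measurable_id _ _ _ _ _ _ _ _ mXt meps j f mf). Qed.

(** The diagonal part is a martingale sum with increments eps^2 - sigma^2. The off-diagonal part is
    a martingale sum whose weight [W j] is itself linear in the errors before [j], so the linear
    bound is applied twice. *)
Lemma quadratic_second_moment (A : 'I_T.+1 -> 'I_T.+1 -> Omega -> R) :
  (forall i j, measurable_fun setT (A i j : OmegaX -> R)) ->
  (\int[P]_w ((\sum_i \sum_j A i j w * (eps i w * eps j w)
      - sigma2 q w * \sum_i A i i w) ^+ 2)%:E <=
   \int[P]_w ((2 * (C + C ^+ 2) + 8 * C ^+ 2) * \sum_i \sum_j A i j w ^+ 2)%:E)%E.
Proof.
move=> mA.
pose U (j i : 'I_T.+1) w := if (i < j)%N then A i j w + A j i w else 0.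
pose W (j : 'I_T.+1) w := \sum_i U j i w * eps i w.
pose Dg w := \sum_i A i i w * (eps i w ^+ 2 - sigma2 q w).
pose Off w := \sum_j W j w * eps j w.
pose SA w := \sum_i \sum_j A i j w ^+ 2.
have SA0 w : 0 <= SA w by apply: sumr_ge0 => i _; apply: sumr_ge0 => j _; exact: sqr_ge0.
have mU j i : measurable_fun setT (U j i : OmegaX -> R).
  by rewrite /U; case: (i < j)%N => //; exact: measurable_funD.
have mA' i j : measurable_fun setT (A i j) by have h := @of_past ord0 _ (@past_of _ (@mA i j) ord0); exact: h.
have mU' j i : measurable_fun setT (U j i) by have h := @of_past ord0 _ (@past_of _ (@mU j i) ord0); exact: h.
have ms : measurable_fun setT (sigma2 q).
  by have h := @of_past ord0 _ (@past_of _ sigma2_measurable ord0); exact: h.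
have mW (j : 'I_T.+1) : measurable_fun setT (W j : Past j -> R).
  apply: measurable_sum => i; have [ij|ij] := ltnP i j; last first.
    have -> : (fun w : Past j => U j i w * eps i w) = cst 0.
      by apply/funext => w; rewrite /U ltnNge ij mul0r.
    exact: measurable_cst.
  by apply: measurable_funM; [exact: (@past_of _ (@mU j i) j)|exact: eps_past_measurable].
have mW' j : measurable_fun setT (W j) by exact: (@of_past j _ (@mW j)).
have mSA : measurable_fun setT SA.
  by apply: measurable_sum => i; apply: measurable_sum => j; exact: measurable_funX.
have mDg : measurable_fun setT Dg.
  apply: measurable_sum => i; apply: measurable_funM => //.
  by apply: measurable_funB => //; exact: measurable_funX.
have mOff : measurable_fun setT Off.
  by apply: measurable_sum => i; exact: measurable_funM.
have E w : \sum_i \sum_j A i j w * (eps i w * eps j w) - sigma2 q w * \sum_i A i i w = Dg w + Off w.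
  rewrite sum_upper_lower addrAC; congr (_ + _).
    rewrite mulr_sumr -sumrB; apply: eq_bigr => i _; ring.
  apply: eq_bigr => j _; rewrite mulr_suml; apply: eq_bigr => i _; rewrite /U.
  by case: ifP => _; ring.
have intZ (b : R) (f : Omega -> R) : 0 <= b -> measurable_fun setT f -> (forall w, 0 <= f w) ->
    (\int[P]_w (b * f w)%:E = b%:E * \int[P]_w (f w)%:E)%E.
  move=> b0 mf f0; under eq_integral do rewrite EFinM.
  by rewrite ge0_integralZl_EFin //; [move=> w _; rewrite lee_fin|exact/measurable_EFinP].
have HDg : (\int[P]_w (Dg w ^+ 2)%:E <= (C + C ^+ 2)%:E * \int[P]_w (SA w)%:E)%E.
  have C20 : 0 <= C + C ^+ 2 by rewrite addr_ge0 // sqr_ge0.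
  apply: le_trans (@diagonal_second_moment (fun i => A i i) (fun i => @past_of _ (@mA i i) i)) _.
  rewrite -intZ //; apply: ge0_le_integral => //.
  - by move=> w _; rewrite lee_fin mulr_ge0 // sumr_ge0 // => i _; exact: sqr_ge0.
  - apply/measurable_EFinP; apply: measurable_funM => //; apply: measurable_sum => i.
    exact: measurable_funX.
  - by apply/measurable_EFinP; exact: measurable_funM.
  move=> w _; rewrite lee_fin ler_wpM2l //; apply: ler_sum => i _.
  by rewrite (bigD1 i) //= lerDl sumr_ge0 // => j _; exact: sqr_ge0.
have HW j : (\int[P]_w (W j w ^+ 2)%:E <= C%:E * \int[P]_w (\sum_i U j i w ^+ 2)%:E)%E.
  rewrite -intZ //.
  - exact: (@linear_second_moment (U j) (fun i => @past_of _ (@mU j i) i)).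
  - by apply: measurable_sum => i; exact: measurable_funX.
  - by move=> w; apply: sumr_ge0 => i _; exact: sqr_ge0.
have HOff : (\int[P]_w (Off w ^+ 2)%:E <= (C * (C * 4))%:E * \int[P]_w (SA w)%:E)%E.
  apply: le_trans (@linear_second_moment W mW) _.
  have mW2 i : measurable_fun setT (fun w => W i w ^+ 2) by exact: measurable_funX.
  have mU2 j : measurable_fun setT (fun w => \sum_i U j i w ^+ 2).
    by apply: measurable_sum => i; exact: measurable_funX.
  have U20 j w : 0 <= \sum_i U j i w ^+ 2 by apply: sumr_ge0 => i _; exact: sqr_ge0.
  rewrite intZ //; last 2 first.
  - by apply: measurable_sum.
  - by move=> w; apply: sumr_ge0 => i _; exact: sqr_ge0.
  rewrite EFinM -muleA; apply: lee_wpmul2l; first by rewrite lee_fin.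
  under eq_integral do rewrite -sumEFin.
  rewrite ge0_integral_sum //; last 2 first.
  - by move=> i; exact/measurable_EFinP.
  - by move=> i w _; rewrite lee_fin sqr_ge0.
  apply: (@le_trans _ _ (\sum_(i < T.+1) (C%:E * \int[P]_w (\sum_k U i k w ^+ 2)%:E))%E).
    by apply: lee_sum => i _; exact: HW.
  rewrite -ge0_sume_distrr; last by move=> i _; apply: integral_ge0 => w _; rewrite lee_fin.
  rewrite EFinM -muleA; apply: lee_wpmul2l; first by rewrite lee_fin.
  rewrite -ge0_integral_sum //; last 2 first.
  - by move=> i; exact/measurable_EFinP.
  - by move=> i w _; rewrite lee_fin.
  rewrite -intZ //; apply: ge0_le_integral => //.
  - by move=> w _; apply: sume_ge0 => i _; rewrite lee_fin.
  - by under eq_fun do rewrite sumEFin; apply/measurable_EFinP; apply: measurable_sum.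
  - by apply/measurable_EFinP; exact: measurable_funM.
  move=> w _; rewrite sumEFin lee_fin.
  (* Origin of the factor 4: (x + y)^2 <= 2 x^2 + 2 y^2, summed over all ordered pairs, counts each
     squared entry of [A] with total weight 4. *)
  apply: (@le_trans _ _ (\sum_j \sum_i (2 * A i j w ^+ 2 + 2 * A j i w ^+ 2))).
    apply: ler_sum => j _; apply: ler_sum => i _; rewrite /U.
    have := sqr_ge0 (A i j w - A j i w); have := sqr_ge0 (A i j w); have := sqr_ge0 (A j i w).
    by case: ifP => _; move: (A i j w) (A j i w) => x y; nra.
  under eq_bigr do rewrite big_split /=; rewrite big_split /= exchange_big /=.
  under eq_bigr do rewrite -mulr_sumr; rewrite -mulr_sumr -/(SA w); lra.
under eq_integral do rewrite E.
(* Splitting the square of [Dg + Off] costs a factor 2, which turns the bounds C + C^2 and 4 C^2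
   into the constant of the statement. *)
apply: (@le_trans _ _ (\int[P]_w ((2 * Dg w ^+ 2)%:E + (2 * Off w ^+ 2)%:E))%E).
  apply: ge0_le_integral => //.
  - by move=> w _; rewrite lee_fin sqr_ge0.
  - by apply/measurable_EFinP; apply: measurable_funX; exact: measurable_funD.
  - by apply: emeasurable_funD; apply/measurable_EFinP; apply: measurable_funM => //; exact: measurable_funX.
  - move=> w _; rewrite -EFinD lee_fin; have := sqr_ge0 (Dg w - Off w).
    by move: (Dg w) (Off w) => x y; nra.
have mDg2 : measurable_fun setT (fun w => Dg w ^+ 2) by exact: measurable_funX.
have mOff2 : measurable_fun setT (fun w => Off w ^+ 2) by exact: measurable_funX.
rewrite ge0_integralD //; last 4 first.
- by move=> w _; rewrite lee_fin mulr_ge0 // sqr_ge0.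
- by apply/measurable_EFinP; exact: measurable_funM.
- by move=> w _; rewrite lee_fin mulr_ge0 // sqr_ge0.
- by apply/measurable_EFinP; exact: measurable_funM.
have C2 := sqr_ge0 C; have C20 : 0 <= C + C ^+ 2 by rewrite addr_ge0.
have B0 : 0 <= 2 * (C + C ^+ 2) + 8 * C ^+ 2 by rewrite addr_ge0 // mulr_ge0.
rewrite !intZ //; try by move=> w; exact: sqr_ge0.
rewrite (EFinD (2 * (C + C ^+ 2))) ge0_muleDl; [|by rewrite lee_fin mulr_ge0|by rewrite lee_fin mulr_ge0].
apply: leeD.
  by rewrite EFinM -muleA; apply: lee_wpmul2l.
rewrite (_ : 8 * C ^+ 2 = 2 * (C * (C * 4))); last by ring.
by rewrite EFinM -muleA; apply: lee_wpmul2l.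
Qed.

End quadratic_forms.

(** * Measurability of matrix-valued maps *)

Section measurable_matrix.
Context {d : measure_display} {Y : measurableType d} {R : realType}.

Definition measurable_mx m n (A : Y -> 'M[R]_(m, n)) :=
  forall i j, measurable_fun setT (fun y => A y i j).

Lemma measurable_mx_cst m n (A : 'M[R]_(m, n)) : measurable_mx (fun=> A).
Proof. by []. Qed.

Lemma measurable_mx_tr m n (A : Y -> 'M[R]_(m, n)) :
  measurable_mx A -> measurable_mx (fun y => (A y)^T).
Proof. by move=> mA i j; under eq_fun do rewrite mxE; exact: mA. Qed.

Lemma measurable_mxM m n p (A : Y -> 'M[R]_(m, n)) (B : Y -> 'M[R]_(n, p)) :
  measurable_mx A -> measurable_mx B -> measurable_mx (fun y => A y *m B y).
Proof.
move=> mA mB i j; under eq_fun do rewrite mxE.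
by apply: measurable_sum => k; exact: measurable_funM.
Qed.

Lemma measurable_mxB m n (A B : Y -> 'M[R]_(m, n)) :
  measurable_mx A -> measurable_mx B -> measurable_mx (fun y => A y - B y).
Proof.
by move=> mA mB i j; under eq_fun do rewrite mxE [X in _ + X]mxE; exact: measurable_funB.
Qed.

Lemma measurable_det n (A : Y -> 'M[R]_n) :
  measurable_mx A -> measurable_fun setT (fun y => \det (A y)).
Proof.
move=> mA; apply: measurable_sum => s; apply: measurable_funM => //.
by apply: measurable_prod => i _; exact: mA.
Qed.

Lemma measurable_inv_real (f : Y -> R) :
  measurable_fun setT f -> measurable_fun setT (fun y => (f y)^-1).
Proof.
move=> mf.
(* [powR] by a fixed exponent is measurable, and [1/x = x * (x^2)^(-1)] *)
have -> : (fun y => (f y)^-1) = fun y => f y * (f y ^+ 2) `^ (-1).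
  apply/funext => y; rewrite powR_inv1 ?sqr_ge0 // expr2 invfM mulrA.
  have [->|f0] := eqVneq (f y) 0; first by rewrite invr0 mulr0.
  by rewrite divff // mul1r.
apply: measurable_funM => //.
by have h := measurableT_comp (measurable_powR (-1)) (measurable_funX 2 mf); exact: h.
Qed.

(** Cramer's rule: invertibility at every point makes each entry a cofactor divided by the
    determinant, both polynomial in the entries. *)
Lemma measurable_mx_inv n (A : Y -> 'M[R]_n) :
  (forall y, A y \in unitmx) -> measurable_mx A -> measurable_mx (fun y => invmx (A y)).
Proof.
move=> uA mA i j; have -> : (fun y => invmx (A y) i j) = fun y => (\det (A y))^-1 * cofactor (A y) j i.
  by apply/funext => y; rewrite /invmx uA !mxE.
apply: measurable_funM; first exact/measurable_inv_real/measurable_det.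
apply: measurable_funM => //; apply: measurable_det => a b.
by under eq_fun do rewrite !mxE; exact: mA.
Qed.

End measurable_matrix.

(** * Linear and quadratic forms in the shifted errors *)

Section lifted_forms.
Context {R : realType} {d : measure_display} {Omega : measurableType d}.

(* [lift ord0] drops [eps 0] (current errors), [lift ord_max] drops [eps T] (lagged errors). *)
Definition lifted T (eps : 'I_T.+1 -> Omega -> R) (k : 'I_T.+1) w : 'cV[R]_T :=
  \col_i eps (lift k i) w.

Lemma errvec_lifted T (eps : 'I_T.+1 -> Omega -> R) w : errvec eps w = lifted eps ord0 w.
Proof. by []. Qed.

Lemma lagvec_lifted T (eps : 'I_T.+1 -> Omega -> R) w : lagvec eps w = lifted eps ord_max w.
Proof. by apply/colP => i; rewrite !mxE; congr (eps _ w); apply: val_inj; rewrite /= /bump leqNgt ltn_ord. Qed.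

(** Weights padded by a zero at the dropped index, so that a form in [e] or [u] becomes a form in
    the full error vector, where the martingale bounds apply. *)
Definition unlift_vec T (k : 'I_T.+1) (h : 'cV[R]_T) (a : 'I_T.+1) : R :=
  if unlift k a is Some i then h i 0 else 0.

Definition unlift_mx T (k l : 'I_T.+1) (M : 'M[R]_T) (a b : 'I_T.+1) : R :=
  if unlift k a is Some i then if unlift l b is Some j then M i j else 0 else 0.

Lemma sum_lift T (k : 'I_T.+1) (F : 'I_T.+1 -> R) :
  F k = 0 -> \sum_a F a = \sum_i F (lift k i).
Proof. by move=> Fk; rewrite (bigD1_ord k) //= Fk add0r. Qed.

Lemma unlift_vecE T (eps : 'I_T.+1 -> Omega -> R) (k : 'I_T.+1) (h : 'cV[R]_T) w :
  \sum_a unlift_vec k h a * eps a w = (h^T *m lifted eps k w) 0 0.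
Proof.
rewrite (sum_lift (k := k)) /unlift_vec ?unlift_none ?mul0r // mxE.
by apply: eq_bigr => i _; rewrite liftK !mxE.
Qed.

Lemma unlift_vec_sqr T (k : 'I_T.+1) (h : 'cV[R]_T) :
  \sum_a unlift_vec k h a ^+ 2 = (h^T *m h) 0 0.
Proof.
rewrite (sum_lift (k := k)) /unlift_vec ?unlift_none ?expr0n // dotmx_sum.
by apply: eq_bigr => i _; rewrite liftK.
Qed.

Lemma unlift_mxE T (eps : 'I_T.+1 -> Omega -> R) (k l : 'I_T.+1) (M : 'M[R]_T) w :
  \sum_a \sum_b unlift_mx k l M a b * (eps a w * eps b w) =
  ((lifted eps k w)^T *m M *m lifted eps l w) 0 0.
Proof.
rewrite (sum_lift (k := k)); last first.
  by rewrite big1 // => b _; rewrite /unlift_mx unlift_none mul0r.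
rewrite -mulmxA mxE; apply: eq_bigr => i _; rewrite !mxE (sum_lift (k := l)); last first.
  by rewrite /unlift_mx unlift_none; case: unlift => [?|]; rewrite mul0r.
rewrite mulr_sumr; apply: eq_bigr => j _; rewrite /unlift_mx !liftK mxE; ring.
Qed.

Lemma unlift_mx_sqr T (k l : 'I_T.+1) (M : 'M[R]_T) :
  \sum_a \sum_b unlift_mx k l M a b ^+ 2 = \sum_i \sum_j M i j ^+ 2.
Proof.
rewrite (sum_lift (k := k)); last first.
  by rewrite big1 // => b _; rewrite /unlift_mx unlift_none expr0n.
apply: eq_bigr => i _; rewrite (sum_lift (k := l)); last first.
  by rewrite /unlift_mx unlift_none; case: unlift => [?|]; rewrite expr0n.
by apply: eq_bigr => j _; rewrite /unlift_mx !liftK.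
Qed.

Lemma unlift_mx_trace T (k : 'I_T.+1) (M : 'M[R]_T) : \sum_a unlift_mx k k M a a = \tr M.
Proof.
rewrite (sum_lift (k := k)); last by rewrite /unlift_mx unlift_none.
by apply: eq_bigr => i _; rewrite /unlift_mx !liftK.
Qed.

(** Index [a] of the full vector is row [a] of [M] for the lagged errors but column [a - 1] for the
    current ones, so the common errors of [e] and [u] meet on the subdiagonal. *)
Lemma unlift_mx_subdiag T (M : 'M[R]_T) :
  \sum_a unlift_mx ord_max ord0 M a a = subdiag_sum M.
Proof.
rewrite (sum_lift (k := ord_max)); last by rewrite /unlift_mx unlift_none.
apply: eq_bigr => i _; rewrite /unlift_mx liftK.
have li : val (lift ord_max i) = val i by rewrite /= /bump leqNgt ltn_ord.
case: unliftP => [j Ej|E0].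
  have ij : val i = (val j).+1 by rewrite -li Ej.
  by rewrite (big_pred1 j) // => j'; rewrite /= ij eqSS eq_sym.
have i0 : val i = 0%N by rewrite -li E0.
by rewrite big_pred0 // => j; rewrite i0.
Qed.

(** Each row contributes at most one entry, and |x| <= 1 + x^2. *)
Lemma subdiag_sum_le T (M : 'M[R]_T) : `|subdiag_sum M| <= T%:R + \sum_i \sum_j M i j ^+ 2.
Proof.
rewrite -unlift_mx_subdiag (sum_lift (k := ord_max)); last by rewrite /unlift_mx unlift_none.
apply: (le_trans (ler_norm_sum _ _ _)).
have -> : T%:R = \sum_(i < T) 1 :> R by rewrite sumr_const card_ord.
rewrite -big_split; apply: ler_sum => i _; rewrite /unlift_mx liftK /=.
have S0 (P : pred 'I_T) : 0 <= \sum_(j | P j) M i j ^+ 2 by apply: sumr_ge0 => j _; exact: sqr_ge0.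
case: unlift => [j|]; last by rewrite normr0 addr_ge0.
rewrite (bigD1 j) //= addrA -(real_normK (num_real (M i j))).
rewrite -[leLHS]addr0; apply: lerD => //.
by move: `|M i j| (normr_ge0 (M i j)) => y; nra.
Qed.

End lifted_forms.

(** * Stochastic orders of the linear and quadratic forms *)

Section op_rates.
Unset Implicit Arguments.
Context {R : realType} {d : measure_display} {Omega : measurableType d}.
Variables (P : probability Omega R) (C : R) (K : nat -> nat).
Variables (Xt : forall T, Omega -> 'M[R]_(T, K T)) (eps : forall T : nat, 'I_T.+1 -> Omega -> R).
Variable q : nat -> Omega -> probability R R.
Hypothesis C0 : 0 <= C.
Hypothesis mXt : forall T i j, measurable_fun setT (fun w => Xt T w i j).
Hypothesis meps : forall T j, measurable_fun setT (eps T j).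
Hypothesis Hiid : forall T, cond_iid P (Xt T) (eps T) (q T).
Hypothesis Hmom : forall T, {ae P, forall w, (\int[q T w]_x (x%:E) = 0)%E /\
  (\int[q T w]_x ((x ^+ 2)%:E) <= C%:E)%E /\ (\int[q T w]_x ((x ^+ 4)%:E) <= C%:E)%E}.
Set Implicit Arguments.
Notation OmegaX T := (g_sigma_algebraType (entry_preimages (Xt T))).

(** Given X~, the second moment is at most [C] times the scaled squared norm of [h], which is only
    O_p(1); that norm serves as the truncation variable. *)
Lemma bigOp1_linear (k : forall T, 'I_T.+1) (h : forall T, Omega -> 'cV[R]_T) :
  (forall T, (0 < T)%N -> measurable_mx (h T : OmegaX T -> _)) ->
  bigOp1 P (fun T w => T%:R * ((h T w)^T *m h T w) 0 0) ->
  bigOp1 P (fun T w => Num.sqrt T%:R * ((h T w)^T *m lifted (eps T) (k T) w) 0 0).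
Proof.
move=> mh hV; apply: (bigOp1_second_moment hV) => M; exists (C * `|M|), 1%N => T T0.
set t := Num.sqrt T%:R.
have t2 : t ^+ 2 = T%:R by rewrite sqr_sqrtr.
pose E := [set w | `|T%:R * ((h T w)^T *m h T w) 0 0| <= M].
have mV : measurable_fun setT (fun w : OmegaX T => T%:R * ((h T w)^T *m h T w) 0 0).
  apply: measurable_funM => //.
  by apply: (measurable_mxM (measurable_mx_tr (mh _ T0)) (mh _ T0)).
have mEX : measurable (E : set (OmegaX T)).
  rewrite -[E]setTI; apply: measurable_fun_le => //.
  exact: measurableT_comp.
have mE : measurable E by exact: (sigmaX_measurable (mXt T) mEX).
(* The truncation event lies in sigma(X~), so its indicator can be put into the weights, which stay
   predictable and have sum of squares at most [|M|]. *)
pose a j w := \1_E w * (t * unlift_vec (k T) (h T w) j).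
have ma' j : measurable_fun setT (a j : OmegaX T -> R).
  apply: measurable_funM; first exact: measurable_indic.
  apply: measurable_funM => //; rewrite /unlift_vec; case: unlift => [i|//].
  exact: mh.
have ma (j : 'I_T.+1) := @sigmaX_past_measurable _ _ _ _ _ _ (Xt T) (eps T) j _ (ma' j).
have mv j : measurable_fun setT (fun w => unlift_vec (k T) (h T w) j).
  rewrite /unlift_vec; case: unlift => [i|//].
  have h1 := measurableT_comp (mh T T0 i 0) (id_sigmaX_measurable (mXt T)); exact: h1.
have mZ : measurable_fun setT (fun w => t * ((h T w)^T *m lifted (eps T) (k T) w) 0 0).
  under eq_fun do rewrite -unlift_vecE.
  by apply: measurable_funM => //; apply: measurable_sum => j; exact: measurable_funM.
split => //; split => //.
have -> : (\int[P]_(w in E) ((t * ((h T w)^T *m lifted (eps T) (k T) w) 0 0) ^+ 2)%:E =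
    \int[P]_w ((\sum_j a j w * eps T j w) ^+ 2)%:E)%E.
  rewrite integral_mkcond; apply: eq_integral => w _; rewrite patchE.
  have -> : \sum_j a j w * eps T j w =
      \1_E w * (t * ((h T w)^T *m lifted (eps T) (k T) w) 0 0).
    rewrite -unlift_vecE !mulr_sumr; apply: eq_bigr => j _; rewrite /a; ring.
  by rewrite indicE; case: (w \in E); rewrite ?mul1r // mul0r expr0n.
apply: le_trans (linear_second_moment (mXt T) (meps T) (Hiid T) C0 (Hmom T) ma) _.
apply: (@le_trans _ _ (\int[P]_w (C * `|M|)%:E)%E).
  apply: ge0_le_integral => //.
  - by move=> w _; rewrite lee_fin mulr_ge0 // sumr_ge0 // => j _; exact: sqr_ge0.
  - apply/measurable_EFinP; apply: measurable_funM => //; apply: measurable_sum => j.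
    apply: measurable_funX; apply: measurable_funM; first exact: measurable_indic.
    exact: measurable_funM.
  move=> w _; rewrite lee_fin ler_wpM2l //.
  have -> : \sum_j a j w ^+ 2 = \1_E w * (T%:R * ((h T w)^T *m h T w) 0 0).
    rewrite -(unlift_vec_sqr (k T)) !mulr_sumr; apply: eq_bigr => j _.
    by rewrite /a indicE -t2; case: (w \in E) => /=; ring.
  rewrite indicE; case: (boolP (w \in E)) => [/[!inE] /= wE|_]; last by rewrite mul0r.
  by rewrite mul1r (le_trans (ler_norm _)) // (le_trans wE) // ler_norm.
by rewrite integral_cst // [X in (_ * X)%E]probability_setT mule1.
Qed.

Lemma bigOp1_quadratic (k l : forall T, 'I_T.+1) (M : forall T, Omega -> 'M[R]_T) :
  (forall T, (0 < T)%N -> measurable_mx (M T : OmegaX T -> _)) ->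
  (forall T, (0 < T)%N -> forall w, \sum_i \sum_j M T w i j ^+ 2 <= T%:R) ->
  bigOp1 P (fun T w => (Num.sqrt T%:R)^-1 *
    (((lifted (eps T) (k T) w)^T *m M T w *m lifted (eps T) (l T) w) 0 0
     - sigma2 (q T) w * \sum_a unlift_mx (k T) (l T) (M T w) a a)).
Proof.
(* The squared entries sum to at most [T] at every sample point, so no truncation is required and
   [V] is taken to be 0. *)
move=> mM HM; apply: (@bigOp1_second_moment _ _ _ P _ (fun _ _ => 0)).
  exact: bigOp1_cst.
move=> N; exists (2 * (C + C ^+ 2) + 8 * C ^+ 2), 1%N => T T0.
set t := Num.sqrt T%:R.
have T0' : 0 < T%:R :> R by rewrite ltr0n.
have t0 : t != 0 by rewrite gt_eqF // sqrtr_gt0.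
have t2 : t ^+ 2 = T%:R by rewrite sqr_sqrtr.
pose A i j w := t^-1 * unlift_mx (k T) (l T) (M T w) i j.
have mA i j : measurable_fun setT (A i j : OmegaX T -> R).
  apply: measurable_funM => //; rewrite /unlift_mx.
  by case: unlift => [a|//]; case: unlift => [b|//]; exact: mM.
have mA2 i j : measurable_fun setT (A i j).
  have h1 := measurableT_comp (mA i j) (id_sigmaX_measurable (mXt T)); exact: h1.
have ms : measurable_fun setT (sigma2 (q T)).
  have h1 := measurableT_comp (sigma2_measurable (Hiid T)) (id_sigmaX_measurable (mXt T)).
  exact: h1.
have E w : t^-1 * (((lifted (eps T) (k T) w)^T *m M T w *m lifted (eps T) (l T) w) 0 0
     - sigma2 (q T) w * \sum_a unlift_mx (k T) (l T) (M T w) a a) =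
    \sum_i \sum_j A i j w * (eps T i w * eps T j w) - sigma2 (q T) w * \sum_i A i i w.
  rewrite mulrBr -unlift_mxE !mulr_sumr; congr (_ - _).
    by apply: eq_bigr => i _; rewrite mulr_sumr; apply: eq_bigr => j _; rewrite /A; ring.
  by apply: eq_bigr => i _; rewrite /A; ring.
have mZ : measurable_fun setT (fun w =>
    \sum_i \sum_j A i j w * (eps T i w * eps T j w) - sigma2 (q T) w * \sum_i A i i w).
  apply: measurable_funB.
    apply: measurable_sum => i; apply: measurable_sum => j.
    by apply: measurable_funM => //; exact: measurable_funM.
  by apply: measurable_funM => //; exact: measurable_sum.
split; first by under eq_fun do rewrite E.
have B0 : 0 <= 2 * (C + C ^+ 2) + 8 * C ^+ 2.
  by have C2 := sqr_ge0 C; rewrite addr_ge0 // mulr_ge0 // addr_ge0.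
have mS : measurable_fun setT (fun w => \sum_i \sum_j A i j w ^+ 2).
  by apply: measurable_sum => i; apply: measurable_sum => j; exact: measurable_funX.
have [N0|N0] := leP 0 N; last first.
  have -> : [set _ | `|0 : R| <= N] = set0 :> set Omega.
    by apply/seteqP; split=> // w /=; rewrite normr0 leNgt N0.
  by split=> //; rewrite integral_set0 lee_fin.
have -> : [set _ | `|0 : R| <= N] = setT :> set Omega.
  by apply/seteqP; split=> // w _ /=; rewrite normr0.
split => //; under eq_integral do rewrite E.
apply: le_trans (quadratic_second_moment (mXt T) (meps T) (Hiid T) C0 (Hmom T) mA) _.
apply: (@le_trans _ _ (\int[P]_w (2 * (C + C ^+ 2) + 8 * C ^+ 2)%:E)%E).
  apply: ge0_le_integral => //.
  - move=> w _; rewrite lee_fin mulr_ge0 // sumr_ge0 // => i _.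
    by rewrite sumr_ge0 // => j _; exact: sqr_ge0.
  - by apply/measurable_EFinP; exact: measurable_funM.
  move=> w _; rewrite lee_fin -[leRHS]mulr1 ler_wpM2l //.
  have -> : \sum_i \sum_j A i j w ^+ 2 = T%:R^-1 * \sum_i \sum_j M T w i j ^+ 2.
    rewrite -(unlift_mx_sqr (k T) (l T)) -t2 -exprVn mulr_sumr; apply: eq_bigr => i _.
    by rewrite mulr_sumr; apply: eq_bigr => j _; rewrite /A exprMn.
  by rewrite mulrC ler_pdivrMr // mul1r HM.
by rewrite integral_cst // [X in (_ * X)%E]probability_setT mule1.
Qed.

End op_rates.

(** * Assembly of the expansion of the OLS error *)

Unset Implicit Arguments.

Theorem theorem1 (R : realType) (d : measure_display) (Omega : measurableType d)
  (P : probability Omega R) (c C : R) (K : nat -> nat)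
  (Xt : forall T : nat, Omega -> 'M[R]_(T, K T))
  (eps : forall T : nat, 'I_T.+1 -> Omega -> R)
  (q : nat -> Omega -> probability R R)
  (alpha beta r : forall T : nat, 'cV[R]_(K T)) :
  0 < c -> c < 1 -> 0 < C ->
  (* measurability of the primitive random variables *)
  (forall T i j, measurable_fun setT (fun w => Xt T w i j)) ->
  (forall T j, measurable_fun setT (eps T j)) ->
  (* (i) full column rank *)
  (forall T, (0 < T)%N -> forall w, \rank (Xt T w) = K T) ->
  (* (ii) conditional i.i.d. given Xt, with moment conditions *)
  (forall T, cond_iid P (Xt T) (eps T) (q T)) ->
  (forall T, {ae P, forall w,
      (\int[q T w]_x (x%:E) = 0)%E /\
      (c%:E < \int[q T w]_x ((x ^+ 2)%:E) < C%:E)%E /\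
      (\int[q T w]_x ((x ^+ 4)%:E) < C%:E)%E}) ->
  (* (iii) *)
  bigOp1 P (fun T w =>
    ((alpha T)^T *m invmx ((T%:R)^-1 *: ((Xt T w)^T *m Xt T w)) *m alpha T) 0 0) ->
  bigOp1 P (fun T w =>
    ((r T)^T *m invmx ((T%:R)^-1 *: ((Xt T w)^T *m Xt T w)) *m r T) 0 0) ->
  (* (iv) *)
  (forall T, (0 < T)%N -> (K T)%:R / T%:R < 1 - c) ->
  littleop1 P (fun T w =>
    let X := Xmat (Xt T w) (alpha T) (lagvec (eps T) w) in
    let y := yvec X (beta T) (errvec (eps T) w) in
    let s2 := sigma2 (q T) w in
    ((r T)^T *m ols X y) 0 0 - ((r T)^T *m beta T) 0 0
    - s2 * ((r T)^T *m invmx (Sbar (Xt T w) s2 (alpha T)) *m alpha T) 0 0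
        * subdiag_sum (annih (Xt T w))).
Proof.
move=> c0 c1 C0 mXt meps rX Hiid Hmom0 Haa Hrr HK.
have uG T w : (0 < T)%N -> (Xt T w)^T *m Xt T w \in unitmx.
  by move=> T0; apply: gram_unitmx; exact: rX.
(* The rank at any one sample point bounds the deterministic [K T]; [point] is such a sample
   point. *)
have KT T : (0 < T)%N -> (K T <= T)%N.
  by move=> T0; rewrite -(rX T T0 point); exact: rank_leq_row.
have Hmom T : {ae P, forall w, (\int[q T w]_x (x%:E) = 0)%E /\
    (\int[q T w]_x ((x ^+ 2)%:E) <= C%:E)%E /\ (\int[q T w]_x ((x ^+ 4)%:E) <= C%:E)%E}.
  apply: filterS (Hmom0 T) => w [h1 [/andP[_ h2] h3]].
  by split=> //; split; exact: ltW.
pose iG T w := invmx ((Xt T w)^T *m Xt T w).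
pose ha T w := Xt T w *m iG T w *m alpha T.
pose hr T w := Xt T w *m iG T w *m r T.
pose M T w := annih (Xt T w).
pose e T w := lifted (eps T) ord_max w.
pose u T w := lifted (eps T) ord0 w.
pose t T : R := Num.sqrt T%:R.
pose aGa T w := ((alpha T)^T *m iG T w *m alpha T) 0 0.
pose rGa T w := ((r T)^T *m iG T w *m alpha T) 0 0.
pose tau T w := subdiag_sum (M T w).
pose s2 T w := sigma2 (q T) w.
pose x1 T w := t T * ((hr T w)^T *m u T w) 0 0.
pose x2 T w := t T * ((hr T w)^T *m e T w) 0 0.
pose x3 T w := t T * ((ha T w)^T *m u T w) 0 0.
pose x4 T w := t T * ((ha T w)^T *m e T w) 0 0.
pose x5 T w := (t T)^-1 * (((e T w)^T *m M T w *m u T w) 0 0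
  - s2 T w * \sum_a unlift_mx ord_max ord0 (M T w) a a).
pose x6 T w := (t T)^-1 * (((e T w)^T *m M T w *m e T w) 0 0
  - s2 T w * \sum_a unlift_mx ord_max ord_max (M T w) a a).
pose x7 T w := T%:R * aGa T w.
pose x8 T w := T%:R * rGa T w.
(* [y] and [z] are the centrings of e' M u and e' M e divided by [T]; with the deviations [x5] and
   [x6] they recover both quadratic forms. *)
pose y T w := s2 T w * tau T w / T%:R.
pose z T w := s2 T w * (T%:R - (K T)%:R) / T%:R.
have gE T w (b : 'cV[R]_(K T)) : (0 < T)%N ->
    (b^T *m invmx ((T%:R)^-1 *: ((Xt T w)^T *m Xt T w)) *m b) 0 0 =
    T%:R * ((Xt T w *m iG T w *m b)^T *m (Xt T w *m iG T w *m b)) 0 0.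
  move=> T0; have Tn0 : (T%:R : R) != 0 by rewrite pnatr_eq0 -lt0n.
  have uZ : T%:R^-1 *: ((Xt T w)^T *m Xt T w) \in unitmx.
    by rewrite unitmxZ ?uG // unitrV unitfE.
  by rewrite invmxZ // invrK -scalemxAr -scalemxAl mxE gram_form ?uG.
have pos : whp P (fun T => [set w | (0 < T)%N]).
  by apply: (@whp_event _ _ _ _ 1%N) => T T0; apply/seteqP; split.
have Oha : bigOp1 P (fun T w => T%:R * ((ha T w)^T *m ha T w) 0 0).
  by apply: (bigOp1_whp pos Haa) => T w T0; rewrite gE.
have Ohr : bigOp1 P (fun T w => T%:R * ((hr T w)^T *m hr T w) 0 0).
  by apply: (bigOp1_whp pos Hrr) => T w T0; rewrite gE.
have mX T : measurable_mx (Xt T : g_sigma_algebraType (entry_preimages (Xt T)) -> _).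
  move=> i j _ Y mY; rewrite setTI; apply: sub_sigma_algebra; by exists i, j, Y.
have miG T : (0 < T)%N ->
    measurable_mx (iG T : g_sigma_algebraType (entry_preimages (Xt T)) -> _).
  move=> T0; apply: measurable_mx_inv; first by move=> w; exact: uG.
  by apply: measurable_mxM => //; exact: measurable_mx_tr.
have mh T (b : 'cV[R]_(K T)) : (0 < T)%N -> measurable_mx
    ((fun w => Xt T w *m iG T w *m b) : g_sigma_algebraType (entry_preimages (Xt T)) -> _).
  move=> T0; apply: measurable_mxM; last exact: measurable_mx_cst.
  by apply: measurable_mxM => //; exact: miG.
have mM T : (0 < T)%N ->
    measurable_mx (M T : g_sigma_algebraType (entry_preimages (Xt T)) -> _).
  move=> T0; apply: measurable_mxB; first exact: measurable_mx_cst.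
  apply: measurable_mxM; last exact: measurable_mx_tr.
  by apply: measurable_mxM => //; exact: miG.
have Msq T w : (0 < T)%N -> \sum_i \sum_j M T w i j ^+ 2 = T%:R - (K T)%:R.
  by move=> T0; rewrite annih_sum_sq ?uG.
have HM T : (0 < T)%N -> forall w, \sum_i \sum_j M T w i j ^+ 2 <= T%:R.
  by move=> T0 w; rewrite Msq // gerBl.
have lin := bigOp1_linear (ltW C0) mXt meps Hiid Hmom.
have quad := bigOp1_quadratic (ltW C0) mXt meps Hiid Hmom.
have O1 : bigOp1 P x1 by exact: (lin (fun T => ord0) hr (fun T => mh T (r T)) Ohr).
have O2 : bigOp1 P x2 by exact: (lin (fun T => ord_max) hr (fun T => mh T (r T)) Ohr).
have O3 : bigOp1 P x3 by exact: (lin (fun T => ord0) ha (fun T => mh T (alpha T)) Oha).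
have O4 : bigOp1 P x4 by exact: (lin (fun T => ord_max) ha (fun T => mh T (alpha T)) Oha).
have O5 : bigOp1 P x5 by exact: (quad (fun T => ord_max) (fun T => ord0) M mM HM).
have O6 : bigOp1 P x6 by exact: (quad (fun T => ord_max) (fun T => ord_max) M mM HM).
have aGaE T w : (0 < T)%N -> aGa T w = ((ha T w)^T *m ha T w) 0 0.
  by move=> T0; rewrite /aGa gram_form ?uG.
have O7 : bigOp1 P x7.
  by apply: (bigOp1_whp pos Oha) => T w T0; rewrite /x7 aGaE.
have O8 : bigOp1 P x8.
  apply: (bigOp1_whp pos (bigOp1D Ohr Oha)) => T w T0.
  rewrite /x8 /rGa gram_form ?uG // -mulrDr !normrM; apply: ler_wpM2l => //.
  by apply: le_trans (dotmx_le _ _) _; exact: ler_norm.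
have s20 T w : 0 <= s2 T w by exact: sigma2_ge0.
have whp_s2 : whp P (fun T => [set w | (0 < T)%N] `&` [set w | s2 T w <= C]).
  apply: whpI => //; apply: whp_ae => T; apply: filterS (Hmom T) => w [_ [h2 _]].
  rewrite /= -lee_fin /s2 /sigma2 fineK //.
  rewrite ge0_fin_numE; first exact: le_lt_trans h2 (ltry _).
  by apply: integral_ge0 => x _; rewrite lee_fin sqr_ge0.
have T0R (T : nat) : (0 < T)%N -> 0 < T%:R :> R by rewrite ltr0n.
(* The subdiagonal sum is at most [T] plus the squared Frobenius norm of [M], hence at most 2 T, and
   sigma^2 <= C almost surely. *)
have Oy : bigOp1 P y.
  apply: (bigOp1_bounded (B := C * 2) whp_s2) => T w [/= T0 s2C].
  have T0' := T0R T T0.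
  rewrite /y normrM normfV (gtr0_norm T0') ler_pdivrMr // normrM (ger0_norm (s20 _ _)) -mulrA.
  apply: ler_pM => //; apply: le_trans (subdiag_sum_le _) _; have := HM T T0 w; lra.
have z_ge0 T w : (0 < T)%N -> 0 <= z T w.
  move=> T0; rewrite divr_ge0 // mulr_ge0 // subr_ge0 ler_nat; exact: KT.
have Oz : bigOp1 P z.
  apply: (bigOp1_bounded (B := C) whp_s2) => T w [/= T0 s2C].
  rewrite ger0_norm ?z_ge0 // /z ler_pdivrMr ?T0R //.
  by apply: ler_pM => //; rewrite ?subr_ge0 ?ler_nat ?KT // gerBl.
pose k T w := 1 + x4 T w / t T.
pose D T w := k T w ^+ 2 + (z T w + x6 T w / t T) * x7 T w.
pose E T w := 1 + z T w * x7 T w.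
(* On this event [k] is at least 1/2. It is the only random event, apart from the bound on sigma^2,
   on which the denominators and bounded factors are controlled. *)
have Ok4 : whp P (fun T => [set w | (0 < T)%N] `&` [set w | `|x4 T w / t T| <= 1 / 2]).
  apply: whpI => //; apply: bigOp1_whp_small; first lra.
  apply: (bigOp1_whp pos O4) => T w T0.
  have tn : t T != 0 by rewrite gt_eqF // sqrtr_gt0 T0R.
  by rewrite (_ : Num.sqrt T%:R * _ = x4 T w) // -/(t T); field.
have tp T : (0 < T)%N -> 0 < t T by move=> T0; rewrite sqrtr_gt0 T0R.
have t2 T : t T ^+ 2 = T%:R by rewrite sqr_sqrtr.
have mE T w : (0 < T)%N -> ((e T w)^T *m M T w *m e T w) 0 0 = t T ^+ 2 * z T w + t T * x6 T w.
  move=> T0; have tn := lt0r_neq0 (tp T T0); have Tn := lt0r_neq0 (T0R T T0).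
  rewrite /x6 /z unlift_mx_trace annih_trace ?uG // t2.
  by move: (_ 0 0) (s2 T w) (t T) tn => m0 v t0 tn; field; rewrite tn Tn.
have DE T w : (0 < T)%N -> D T w = k T w ^+ 2 + ((e T w)^T *m M T w *m e T w) 0 0 * aGa T w.
  move=> T0; have tn := lt0r_neq0 (tp T T0).
  by rewrite mE // /D /x7 -t2; congr (_ + _); field.
have aGa0 T w : (0 < T)%N -> 0 <= aGa T w by move=> T0; rewrite aGaE // dotmx_ge0.
have k_ge T w : `|x4 T w / t T| <= 1 / 2 -> 1 / 2 <= k T w.
  by rewrite ler_norml => /andP[h _]; rewrite /k; lra.
(* [DE] returns to the uncentred form e' M e, which is nonnegative although its centred part [x6]
   has no sign; hence [D] is at least k^2. *)
have D_ge T w : (0 < T)%N -> `|x4 T w / t T| <= 1 / 2 -> 1 / 4 <= D T w.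
  move=> T0 /k_ge kh; rewrite DE //.
  have : 0 <= ((e T w)^T *m M T w *m e T w) 0 0 * aGa T w.
    by rewrite mulr_ge0 ?aGa0 // annih_form_ge0 // uG.
  by move: (_ * aGa T w) => v; move: (k T w) kh => kk; nra.
have E_ge T w : (0 < T)%N -> 1 <= E T w.
  by move=> T0; rewrite lerDl mulr_ge0 ?z_ge0 // mulr_ge0 // aGa0.
have inv_bound (v b : R) : 0 < b -> b <= v -> `|v^-1| <= b^-1.
  by move=> b0 bv; rewrite normfV lef_pV2 ?posrE ?normr_gt0 ?ger0_norm ?gt_eqF //; lra.
have Ok : bigOp1 P k.
  apply: (bigOp1_bounded (B := 2) Ok4) => T w [/= _ h].
  by apply: (le_trans (ler_normD _ _)); rewrite normr1; lra.
have Okv : bigOp1 P (fun T w => (k T w)^-1).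
  by apply: (bigOp1_bounded (B := (1 / 2)^-1) Ok4) => T w [/= _ h]; apply: inv_bound (k_ge _ _ h); lra.
have ODv : bigOp1 P (fun T w => (D T w)^-1).
  apply: (bigOp1_bounded (B := (1 / 4)^-1) Ok4) => T w [/= T0 h].
  by apply: inv_bound (D_ge _ _ T0 h); lra.
have OEv : bigOp1 P (fun T w => (E T w)^-1).
  by apply: (bigOp1_bounded (B := 1^-1) pos) => T w T0; apply: inv_bound (E_ge _ _ T0).
have Otv : bigOp1 P (fun T w => (t T)^-1).
  apply: (bigOp1_bounded (B := 1^-1) pos) => T w /= T0; apply: inv_bound => //.
  by rewrite -sqrtr1 ler_sqrt // ler1n.
(* The right-hand side of [scaled_error_expansion]: it contains only sums and products of sequences
   already known to be O_p(1), inverses included. *)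
pose W T w := x1 T w - x2 T w * x3 T w * (k T w)^-1 * (t T)^-1
    - x2 T w * x7 T w * (k T w)^-1 * (D T w)^-1 *
        (k T w * (y T w + x5 T w * (t T)^-1) - (z T w + x6 T w * (t T)^-1) * x3 T w * (t T)^-1)
    - x8 T w * (z T w + x6 T w * (t T)^-1) * x3 T w * (D T w)^-1
    + x8 T w * k T w * x5 T w * (D T w)^-1
    + x8 T w * y T w * (x4 T w * z T w * x7 T w - k T w * x4 T w - x6 T w * x7 T w)
        * (D T w)^-1 * (E T w)^-1.
have OW : bigOp1 P W.
  by rewrite /W; repeat first [assumption | apply: bigOp1D | apply: bigOp1N | apply: bigOp1M].
(* It suffices that sqrt T times the difference is O_p(1); on the event of [Ok4] it equals [W]
   exactly. *)
apply: bigOp1_littleop1; apply: (bigOp1_whp Ok4 OW) => T w [/= T0 h].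
have tn := lt0r_neq0 (tp T T0); have Tn := lt0r_neq0 (T0R T T0).
have k0 : k T w != 0 by rewrite gt_eqF //; have := k_ge _ _ h; lra.
have D0 : D T w != 0 by rewrite gt_eqF //; have := D_ge _ _ T0 h; lra.
have E0 : E T w != 0 by rewrite gt_eqF //; have := E_ge T w T0; lra.
rewrite lagvec_lifted errvec_lifted -/(e T w) -/(u T w) -/(s2 T w).
have kE : 1 + ((ha T w)^T *m e T w) 0 0 = k T w.
  by rewrite /k /x4; congr (1 + _); field.
have [] := @ols_error_formula _ _ _ (Xt T w) (alpha T) (r T) (e T w) (u T w) (uG T w T0).
- by rewrite kE.
- by rewrite kE -DE.
rewrite -/(Xmat (Xt T w) (alpha T) (e T w)) => uX.
rewrite -/(iG T w) -/(ha T w) -/(hr T w) -/(aGa T w) -/(rGa T w) kE => olsE.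
(* Cancelling [beta] requires X'X to be invertible, which [ols_error_formula] provides on this
   event. *)
have -> : ((r T)^T *m ols (Xmat (Xt T w) (alpha T) (e T w))
      (yvec (Xmat (Xt T w) (alpha T) (e T w)) (beta T) (u T w))) 0 0 - ((r T)^T *m beta T) 0 0 =
    ((r T)^T *m (invmx ((Xmat (Xt T w) (alpha T) (e T w))^T *m Xmat (Xt T w) (alpha T) (e T w)) *m
      (Xmat (Xt T w) (alpha T) (e T w))^T *m u T w)) 0 0.
  rewrite /ols /yvec; move: (Xmat _ _ _) uX => X uX.
  have -> : invmx (X^T *m X) *m X^T *m (X *m beta T + u T w) =
      beta T + invmx (X^T *m X) *m X^T *m u T w.
    by rewrite mulmxDr -mulmxA (mulmxA X^T) mulKmx.
  by rewrite mulmxDr [X in X - _]mxE [X in X - _]addrC addrK.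
rewrite olsE (Sbar_form _ _ (uG T w T0)) ?KT // -/(iG T w) -/(rGa T w) -/(aGa T w).
rewrite -/(M T w) -/(tau T w).
have := @scaled_error_expansion _ (t T) (x1 T w) (x2 T w) (x3 T w) (x4 T w) (x5 T w) (x6 T w)
  (x7 T w) (x8 T w) (y T w) (z T w) tn k0 D0 E0.
rewrite -/(k T w) -/(D T w) -/(E T w) -/(W T w) => <-.
have A1E : ((hr T w)^T *m u T w) 0 0 = x1 T w / t T by rewrite /x1; field.
have pE : ((hr T w)^T *m e T w) 0 0 = x2 T w / t T by rewrite /x2; field.
have bE : ((ha T w)^T *m u T w) 0 0 = x3 T w / t T by rewrite /x3; field.
have aE : aGa T w = x7 T w / t T ^+ 2 by rewrite /x7 -t2; field.
have rE : rGa T w = x8 T w / t T ^+ 2 by rewrite /x8 -t2; field.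
have sE : ((e T w)^T *m M T w *m u T w) 0 0 = t T * x5 T w + t T ^+ 2 * y T w.
  rewrite /x5 /y unlift_mx_subdiag -/(tau T w) -t2.
  by move: (_ 0 0) (s2 T w) (tau T w) => m0 v0 v1; field.
have EE : 1 + s2 T w * (T%:R - (K T)%:R) * aGa T w = E T w.
  by rewrite /E /z /x7; field.
have tgE : s2 T w * (rGa T w / E T w) * tau T w = x8 T w * y T w / E T w.
  by rewrite /x8 /y; move: (E T w) E0 => E1 E10; field; rewrite Tn E10.
rewrite EE tgE -DE // sE mE // A1E pE bE; move: (D T w) (k T w) (E T w) => D1 k1 E1.
by rewrite aE rE.
Qed.
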